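(* The Shortest Path with Forcing Graph problem admits a kernel with ${\mathcal O}(k^3)$ vertices when $G_f$ is either a cluster graph or a graph with bounded degree.
   Context: Shortest Path with Forcing Graph: the input is a simple, undirected, unweighted graph $G=(V,E)$ (arbitrary), two distinct vertices $s,t\in V(G)$, a positive integer $k$, and a forcing graph $G_f=(E,E')$ whose vertex set is the edge set of $G$. The question is whether there is a set $E^*\subseteq E$ of at most $k$ edges such that the subgraph $(V,E^* )$ contains an $s$-$t$ path and $E^*$ is a vertex cover of $G_f$. The parameter is $k$. A cluster graph is a graph in which every connected component is a clique; bounded degree means maximum degree at most a fixed constant $\eta$. *)

(* Defs.v *)
From HB Require Import structures.
From mathcomp Require Import all_boot.

Set Implicit Arguments.
Unset Strict Implicit.
Unset Printing Implicit Defensive.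

Record graph (T : finType) := Graph {
  adj :> rel T;
  adj_sym : symmetric adj;
  adj_irrefl : irreflexive adj }.

Definition edge_set (T : finType) (G : graph T) : {set {set T}} :=
  [set [set p.1; p.2] | p : T * T & G p.1 p.2].

Definition edge (T : finType) (G : graph T) : finType :=
  {e : {set T} | e \in edge_set G}.

Definition clique (T : finType) (G : graph T) (A : {set T}) : Prop :=
  {in A &, forall x y, x != y -> G x y}.

Definition cluster_graph (T : finType) (G : graph T) : Prop :=
  forall x : T, clique G [set y | connect G x y].

Definition max_degree_le (eta : nat) (T : finType) (G : graph T) : Prop :=
  forall x : T, #|[set y | G x y]| <= eta.

Definition vertex_cover (T : finType) (G : graph T) (S : {set T}) : Prop :=
  forall x y : T, G x y -> (x \in S) || (y \in S).

Record instance := Instance {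
  ivertex : finType;
  igraph : graph ivertex;
  isrc : ivertex;
  idst : ivertex;
  ibudget : nat;
  iforcing : graph (edge igraph);
  isrc_neq_idst : isrc != idst;
  ibudget_gt0 : 0 < ibudget }.

(* The adjacency relation of the spanning subgraph (V, Es). *)
Definition sub_adj (T : finType) (G : graph T) (Es : {set edge G}) : rel T :=
  fun u v => [exists e in Es, val e == [set u; v]].

Definition has_path (T : finType) (r : rel T) (x y : T) : Prop :=
  exists p : seq T, [/\ path r x p, last x p = y & uniq (x :: p)].

Definition yes_instance (I : instance) : Prop :=
  exists Es : {set edge (igraph I)},
    [/\ #|Es| <= ibudget I,
        has_path (sub_adj Es) (isrc I) (idst I)
      & vertex_cover (iforcing I) Es].

(* Running time is measured in the WHILE language over binary trees
   (N. D. Jones, Computability and Complexity from a Programming Perspective).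
   Unlike in Jones' unit-cost measure, reading a variable costs the size of the
   tree it holds, so that every tree built within time n has size at most
   n + (input size), even without sharing, and polynomial time for functions
   (not only for decision problems) is the one of Turing machines. *)
Inductive tree := Leaf | Node of tree & tree.

Fixpoint tree_size (t : tree) : nat :=
  if t is Node a b then (tree_size a + tree_size b).+1 else 1.

Fixpoint tree_eqb (t u : tree) : bool :=
  match t, u with
  | Leaf, Leaf => true
  | Node a b, Node c d => tree_eqb a c && tree_eqb b d
  | _, _ => false
  end.

(* Leaf is false, every other tree is true. *)
Definition truthy (t : tree) : bool := if t is Leaf then false else true.

Inductive expr :=
  | Var of nat
  | Nil
  | Cons of expr & expr
  | Hd of expr
  | Tl of expr
  | Eq of expr & expr.

Inductive com :=
  | Skip
  | Assign of nat & expr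
  | Seq of com & com
  | If of expr & com & com
  | While of expr & com.

Definition store := nat -> tree.

Definition upd (s : store) (i : nat) (t : tree) : store :=
  fun j => if j == i then t else s j.

Fixpoint eval (s : store) (e : expr) : tree :=
  match e with
  | Var i => s i
  | Nil => Leaf
  | Cons a b => Node (eval s a) (eval s b)
  | Hd a => if eval s a is Node t _ then t else Leaf
  | Tl a => if eval s a is Node _ t then t else Leaf
  | Eq a b => if tree_eqb (eval s a) (eval s b) then Node Leaf Leaf else Leaf
  end.

Fixpoint cost (s : store) (e : expr) : nat :=
  match e with
  | Var i => tree_size (s i)
  | Nil => 1
  | Cons a b | Eq a b => (cost s a + cost s b).+1
  | Hd a | Tl a => (cost s a).+1
  end.

(* exec c s n s': started in store s, c halts in store s' after time n. *)
Inductive exec : com -> store -> nat -> store -> Prop :=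
  | ExecSkip s : exec Skip s 1 s
  | ExecAssign s i e : exec (Assign i e) s (cost s e).+1 (upd s i (eval s e))
  | ExecSeq c1 c2 s1 s2 s3 n1 n2 :
      exec c1 s1 n1 s2 -> exec c2 s2 n2 s3 ->
      exec (Seq c1 c2) s1 (n1 + n2).+1 s3
  | ExecIfTrue e c1 c2 s s' n :
      truthy (eval s e) -> exec c1 s n s' ->
      exec (If e c1 c2) s (cost s e + n).+1 s'
  | ExecIfFalse e c1 c2 s s' n :
      ~~ truthy (eval s e) -> exec c2 s n s' ->
      exec (If e c1 c2) s (cost s e + n).+1 s'
  | ExecWhileFalse e c s :
      ~~ truthy (eval s e) -> exec (While e c) s (cost s e).+1 s
  | ExecWhileTrue e c s1 s2 s3 n1 n2 :
      truthy (eval s1 e) -> exec c s1 n1 s2 -> exec (While e c) s2 n2 s3 ->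
      exec (While e c) s1 (cost s1 e + n1 + n2).+1 s3.

(* Input and output are passed in variable 0. *)
Definition computes (c : com) (x : tree) (n : nat) (y : tree) : Prop :=
  exists s : store, exec c (upd (fun=> Leaf) 0 x) n s /\ s 0 = y.

Definition enc_seq : seq tree -> tree := foldr Node Leaf.

Definition enc_nat (n : nat) : tree := enc_seq (nseq n Leaf).

Definition computable (g : nat -> nat) : Prop :=
  exists c : com, forall k : nat,
    exists n : nat, computes c (enc_nat k) n (enc_nat (g k)).

(* l lists every edge of G exactly once, in some order and orientation. *)
Definition edge_listing (T : finType) (G : graph T) (l : seq (T * T)) : Prop :=
  perm_eq [seq [set p.1; p.2] | p <- l] (enum (edge_set G)).

Definition enc_edges (T : finType) (label : T -> nat) (l : seq (T * T)) : tree :=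
  enc_seq [seq Node (enc_nat (label p.1)) (enc_nat (label p.2)) | p <- l].

(* Vertices are numbered 0, 1, ..., #|V| - 1 in some order, an edge of G is
   named in the forcing graph by its position in the edge list of G, and all
   numbers, including the parameter, are written in unary. *)
Definition encodes (x : tree) (I : instance) : Prop :=
  exists (vs : seq (ivertex I)) (es : seq (ivertex I * ivertex I))
         (fs : seq (edge (igraph I) * edge (igraph I))),
    let vlabel v := index v vs in
    let elabel (e : edge (igraph I)) :=
      index (val e) [seq [set p.1; p.2] | p <- es] in
    [/\ perm_eq vs (enum (ivertex I)),
        edge_listing (igraph I) es,
        edge_listing (iforcing I) fs
      & x = enc_seq [:: enc_nat (size vs);
                        enc_edges vlabel es;
                        enc_edges elabel fs;
                        enc_nat (vlabel (isrc I));
                        enc_nat (vlabel (idst I));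
                        enc_nat (ibudget I)]].

(* The restriction of the problem to the instances satisfying P admits a kernel
   with at most h k vertices: a polynomial-time program maps each encoded
   instance satisfying P to an equivalent one, again satisfying P, of size at
   most g k for a computable g.  The new parameter is part of that size, being
   encoded in unary. *)
Definition admits_kernel (P : instance -> Prop) (h : nat -> nat) : Prop :=
  exists (c : com) (a d : nat) (g : nat -> nat), computable g /\
    forall (x : tree) (I : instance), encodes x I -> P I ->
      exists (n : nat) (y : tree) (J : instance),
        [/\ computes c x n y /\ n <= a * tree_size x ^ d,
            encodes y J /\ P J,
            yes_instance I <-> yes_instance J,
            tree_size y <= g (ibudget I)
          & #|ivertex J| <= h (ibudget I)].

(* Main.v *)
From HB Require Import structures.
Require Import Defs.
From mathcomp Require Import all_boot.
From mathcomp Require Import zify.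

(** Call an edge of G forced if it is not isolated in G_f. A vertex cover of size
   at most k leaves at most one uncovered neighbor per chosen vertex if G_f is a
   cluster graph, and at most eta if its degrees are bounded; so a yes-instance
   has at most 2k, resp. (1 + eta)k, forced edges. Let X consist of s, t and the
   endpoints of the forced edges. Free edges only serve to connect vertices of X,
   so it suffices to preserve, for x, y in X and j <= k, whether the free edges
   contain a walk of length at most j from x to y. Free edges are deleted
   greedily as long as this information is unchanged; afterwards each remaining
   free edge lies on one fixed shortest walk of some pair of X, whence at most
   |X|^2 k = O(k^3) of them remain.

   The algorithm runs on trees: a vertex is the tree naming it in the input, an
   edge is [Node u v], and an edge of G_f is [Node e e']. *)

Set Implicit Arguments.
Unset Strict Implicit.
Unset Printing Implicit Defensive.

(** * Polynomial-time computable functions *)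

(** Rerouting must not exceed the budget. The solution path is therefore taken simple: each of its
    free edges lies in one segment between consecutive forced edges, and each segment is exchanged
    for a walk that is no longer. The forced edges of the solution stay, and with them the cover of
    [G_f]; the converse direction is inclusion of edge sets. One greedy pass suffices because
    reachability is monotone in the edge set: an edge that could not be deleted when it was examined
    cannot be deleted later. Both graph classes can be read off the edge list of [G_f], which the
    kernel keeps, so membership survives the loss of isolated vertices. The formal obstacle is the
    running time. This shapes the functions of the algorithm. *)

Lemma tree_eqP : Equality.axiom tree_eqb.
Proof.
elim=> [|a IHa b IHb] [|c d] /=; try by constructor.
by apply: (iffP andP) => [[/IHa-> /IHb->]|[<- <-]] //; split; [apply/IHa|apply/IHb].
Qed.

HB.instance Definition _ := hasDecEq.Build tree tree_eqP.

Definition thd (t : tree) : tree := if t is Node a _ then a else Leaf.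
Definition ttl (t : tree) : tree := if t is Node _ b then b else Leaf.
Definition enc_bool (b : bool) : tree := if b then Node Leaf Leaf else Leaf.

Lemma tree_size_gt0 t : 0 < tree_size t.
Proof. by case: t. Qed.

Lemma enc_bool_inj : injective enc_bool.
Proof. by do 2!case. Qed.

Lemma enc_seq_inj : injective enc_seq.
Proof. by elim=> [|x s IH] [|y u] //= [-> /IH->]. Qed.

Lemma enc_nat_inj : injective enc_nat.
Proof. by move=> m n /enc_seq_inj/(congr1 size); rewrite !size_nseq. Qed.

Lemma tree_size_nat n : tree_size (enc_nat n) = n.*2.+1.
Proof. by elim: n => //= n; rewrite /enc_nat /= => ->. Qed.

Lemma tree_size_cat s u :
  tree_size (enc_seq (s ++ u)) < tree_size (enc_seq s) + tree_size (enc_seq u).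
Proof. elim: s => //= x s IH; lia. Qed.

Lemma size_enc_seq s : size s < tree_size (enc_seq s).
Proof. elim: s => //= x s IH; have := tree_size_gt0 x; lia. Qed.

Lemma tree_size_le_seq n s : {in s, forall x, tree_size x <= n} ->
  tree_size (enc_seq s) <= (size s * n.+1).+1.
Proof.
elim: s => //= x s IH H; have := H x (mem_head _ _).
have: tree_size (enc_seq s) <= (size s * n.+1).+1.
  by apply: IH => y ys; apply: H; rewrite inE ys orbT.
lia.
Qed.

Lemma tree_size_sub_map (D : eqType) (h : D -> tree) (s u : seq D) :
  subseq s u -> tree_size (enc_seq (map h s)) <= tree_size (enc_seq (map h u)).
Proof.
elim: u s => [|y u IH] [|x s] //=.
case: eqP => [->|_] /IH /=; lia.
Qed.

Lemma eval_size s e : tree_size (eval s e) <= cost s e.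
Proof.
elim: e => //= [a IHa b IHb|a|a|a IHa b IHb]; first (by lia).
- by case: (eval s a) => //= *; lia.
- by case: (eval s a) => //= *; lia.
have Ha := tree_size_gt0 (eval s a); have Hb := tree_size_gt0 (eval s b).
case: tree_eqb => /=; lia.
Qed.

Lemma exec_size c s n s' :
  exec c s n s' -> forall i, tree_size (s' i) <= tree_size (s i) + n.
Proof.
elim=> {c s n s'} //.
- by move=> *; lia.
- move=> s i e j; rewrite /upd; case: eqP => [->|_]; have := eval_size s e; lia.
- by move=> c1 c2 s1 s2 s3 n1 n2 _ H1 _ H2 i; move: (H1 i) (H2 i); lia.
- by move=> e c1 c2 s s' n _ _ H i; move: (H i); lia.
- by move=> e c1 c2 s s' n _ _ H i; move: (H i); lia.
- by move=> *; lia.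
by move=> e c s1 s2 s3 n1 n2 _ _ H1 _ H2 i; move: (H1 i) (H2 i); lia.
Qed.

(* The offset 2 lets [inp vs a ^ d], without a leading constant, absorb sums
   and constant factors. *)
Definition inp A (vs : seq (A -> tree)) (a : A) : nat :=
  (\sum_(v <- vs) tree_size (v a)).+2.

Definition bd A (vs : seq (A -> tree)) (q : A -> nat) : Prop :=
  exists d, forall a, q a <= inp vs a ^ d.

(* [f a] can be computed in polynomial time from the values [v a], [v \in vs]:
   the program [F r m] reads the variables [r], writes [m], and leaves every
   other variable below [m] unchanged. *)
Definition pt A (vs : seq (A -> tree)) (f : A -> tree) : Prop :=
  exists (F : seq nat -> nat -> com) (d : nat),
  forall (a : A) (r : seq nat) (m : nat) (s : store),
    all (gtn m) r -> [seq s i | i <- r] = [seq v a | v <- vs] ->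
  exists n s',
    [/\ exec (F r m) s n s', s' m = f a, forall i, i < m -> s' i = s i
      & n <= inp vs a ^ d].

Fixpoint pts A (vs us : seq (A -> tree)) : Prop :=
  if us is u :: us' then pt vs u /\ pts vs us' else True.

(** * Polynomial bounds in the input size, and closure under expressions, branching and
    composition *)

Section Bounds.
Variables (A : Type) (vs : seq (A -> tree)).
Implicit Types (q : A -> nat).

Lemma bd_le q q' : (forall a, q a <= q' a) -> bd vs q' -> bd vs q.
Proof. by move=> H [d Hd]; exists d => a; apply: leq_trans (H a) (Hd a). Qed.

Lemma bd_const n : bd vs (fun=> n).
Proof.
exists n => a; apply: leq_trans (ltnW (ltn_expl n (ltnSn 1))) _.
by case: n => // n; rewrite leq_exp2r.
Qed.

Lemma bd_mul q q' : bd vs q -> bd vs q' -> bd vs (fun a => q a * q' a).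
Proof.
by move=> [d H] [d' H']; exists (d + d') => a; rewrite expnD leq_mul.
Qed.

(** Positive numbers satisfy [y + z <= 2 * y * z], and the base [inp vs a] is at least 2, so one
    extra factor of the base absorbs the sum. *)
Lemma bd_add q q' : bd vs q -> bd vs q' -> bd vs (fun a => q a + q' a).
Proof.
move=> [d H] [d' H']; exists (1 + (d + d')) => a; rewrite !expnD expn1.
have := H a; have := H' a; set x := inp vs a.
have: 0 < x ^ d /\ 0 < x ^ d' by rewrite !expn_gt0.
have: 1 < x by [].
move: (x ^ d) (x ^ d') => y z xgt1 [y_gt0 z_gt0] Hz Hy.
apply: leq_trans (leq_mul xgt1 (leqnn _)).
by have := leq_pmulr y z_gt0; have := leq_pmull z y_gt0; lia.
Qed.

Lemma bd_S q : bd vs q -> bd vs (fun a => (q a).+1).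
Proof.
by move=> H; apply: bd_le (bd_add H (bd_const 1)) => a; rewrite addn1.
Qed.

Lemma bd_exp q d : bd vs q -> bd vs (fun a => q a ^ d).
Proof.
move=> [e H]; exists (e * d) => a; rewrite expnM.
by case: d => // d; rewrite leq_exp2r.
Qed.

Lemma bd_inp : bd vs (inp vs).
Proof. by exists 1 => a; rewrite expn1. Qed.

Lemma bd_comp B (ws : seq (B -> tree)) (h : A -> B) (q : B -> nat) :
  bd vs (fun a => inp ws (h a)) -> bd ws q -> bd vs (fun a => q (h a)).
Proof. by move=> H [d Hd]; apply: bd_le (bd_exp d H) => a; apply: Hd. Qed.

(** The cost model lets no register grow by more than the elapsed time. The program is run with its
    inputs in the registers below [size vs]; its output register starts as [Leaf], so the output has
    size at most the running time plus 1. *)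
Lemma pt_bd f : pt vs f -> bd vs (fun a => tree_size (f a)).
Proof.
move=> [F [d H]]; exists d.+1 => a.
pose s i := nth Leaf [seq v a | v <- vs] i.
have [||n [s' [Hx <- _ Hn]]] := H a (iota 0 (size vs)) (size vs) s.
- by apply/allP => i; rewrite mem_iota /= add0n.
- apply: (@eq_from_nth _ Leaf) => [|i]; rewrite !size_map size_iota // => Hi.
  by rewrite (nth_map 0) ?size_iota // nth_iota.
have := exec_size Hx (size vs); rewrite {1}/s nth_default ?size_map //= => Hs.
apply: leq_trans Hs _; move: Hn.
rewrite expnS; have: 0 < inp vs a ^ d by rewrite expn_gt0.
have: 1 < inp vs a by [].
move: (inp vs a) (inp vs a ^ d) => x y xgt1 ygt0 Hn.
by apply: leq_trans (leq_mul xgt1 (leqnn _)); lia.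
Qed.

End Bounds.

Lemma map_agree (s s' : store) (r : seq nat) m :
  (forall i, i < m -> s' i = s i) -> all (gtn m) r ->
  [seq s' i | i <- r] = [seq s i | i <- r].
Proof. by move=> H /allP Hr; apply/eq_in_map => i /Hr /H. Qed.

Lemma all_gtnW m n (r : seq nat) : m <= n -> all (gtn m) r -> all (gtn n) r.
Proof. by move=> H; apply: sub_all => i /= Hi; apply: leq_trans Hi H. Qed.

Section Closure.
Variables (A : Type) (vs : seq (A -> tree)).
Implicit Types (f g h : A -> tree).

Lemma pt_ext f g : f =1 g -> pt vs f -> pt vs g.
Proof.
move=> E [F [d H]]; exists F, d => a r m s Hr Hs.
by have [n [s' []]] := H a r m s Hr Hs; rewrite E; exists n, s'.
Qed.

Lemma bd_pts us : pts vs us -> bd vs (fun a => \sum_(u <- us) tree_size (u a)).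
Proof.
elim: us => [_|u us IH [/pt_bd Hu /IH H]].
  by apply: bd_le (bd_const _ 0) => a; rewrite big_nil.
by apply: bd_le (bd_add Hu H) => a; rewrite big_cons.
Qed.

(** Each program runs with an output register one higher than its predecessor, so earlier results
    lie below its threshold and survive. *)
Lemma pts_exec us : pts vs us ->
  exists (F : seq nat -> nat -> com) (q : A -> nat), bd vs q /\
  forall (a : A) (r : seq nat) (m : nat) (s : store),
    all (gtn m) r -> [seq s i | i <- r] = [seq v a | v <- vs] ->
  exists n s',
    [/\ exec (F r m) s n s',
        [seq s' i | i <- iota m (size us)] = [seq u a | u <- us],
        forall i, i < m -> s' i = s i & n <= q a].
Proof.
elim: us => [_|u us IH [[Fu [du Hu]] /IH [F [q [Hq HF]]]]] /=.
  exists (fun _ _ => Skip), (fun=> 1); split; first exact: bd_const.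
  by move=> a r m s Hr Hs; exists 1, s; split => //; constructor.
exists (fun r m => Seq (Fu r m) (F r m.+1)), (fun a => inp vs a ^ du + q a + 1).
split.
  by do ![exact: bd_const | exact: Hq | exact: bd_inp | apply: bd_exp | apply: bd_add].
move=> a r m s Hr Hs.
have [n [s' [Hx Hm Hi Hn]]] := Hu a r m s Hr Hs.
have Hr' := all_gtnW (leqnSn m) Hr.
have [|n' [s2 [Hx' Hm' Hi' Hn']]] := HF a r m.+1 s' Hr'.
  by rewrite (map_agree Hi Hr).
exists (n + n').+1, s2; split.
- exact: ExecSeq Hx Hx'.
- by rewrite Hi' // Hm Hm'.
- by move=> i im; rewrite Hi' ?Hi // ltnW.
- by lia.
Qed.

Lemma pt_expr us (e : nat -> expr) f : pts vs us ->
  (forall a m s, [seq s i | i <- iota m (size us)] = [seq u a | u <- us] ->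
     eval s (e m) = f a /\
     cost s (e m) <= (\sum_(u <- us) tree_size (u a)).+1) ->
  pt vs f.
Proof.
move=> Hus He; have [F [q [Hq HF]]] := pts_exec Hus.
have [d Hd]: bd vs (fun a => q a + \sum_(u <- us) tree_size (u a) + 3).
  do ![exact: bd_const | exact: bd_pts | exact: Hq | apply: bd_add].
exists (fun r m => Seq (F r m) (Assign m (e m))), d => a r m s Hr Hs.
have [n [s' [Hx /He [Em Cm] Hi Hn]]] := HF a r m s Hr Hs.
exists (n + (cost s' (e m)).+1).+1, (upd s' m (eval s' (e m))); split.
- by apply: ExecSeq Hx _; apply: ExecAssign.
- by rewrite /upd eqxx.
- by move=> i im; rewrite /upd ltn_eqF // Hi.
- by apply: leq_trans (Hd a); lia.
Qed.

Lemma pt_nil : pt vs (fun=> Leaf).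
Proof. exact: (@pt_expr [::] (fun=> Defs.Nil)). Qed.

Lemma pt_cons f g : pt vs f -> pt vs g -> pt vs (fun a => Node (f a) (g a)).
Proof.
move=> Hf Hg; apply: (@pt_expr [:: f; g] (fun m => Defs.Cons (Var m) (Var m.+1))) => //.
by move=> a m s [/= -> ->]; rewrite !big_cons big_nil addn0.
Qed.

Lemma pt_hd f : pt vs f -> pt vs (fun a => thd (f a)).
Proof.
move=> Hf; apply: (@pt_expr [:: f] (fun m => Hd (Var m))) => //.
by move=> a m s [/= ->]; rewrite !big_cons big_nil addn0.
Qed.

Lemma pt_tl f : pt vs f -> pt vs (fun a => ttl (f a)).
Proof.
move=> Hf; apply: (@pt_expr [:: f] (fun m => Tl (Var m))) => //.
by move=> a m s [/= ->]; rewrite !big_cons big_nil addn0.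
Qed.

Lemma pt_eq f g : pt vs f -> pt vs g -> pt vs (fun a => enc_bool (f a == g a)).
Proof.
move=> Hf Hg; apply: (@pt_expr [:: f; g] (fun m => Eq (Var m) (Var m.+1))) => //.
by move=> a m s [/= -> ->]; rewrite !big_cons big_nil addn0.
Qed.

(** Variable access: contexts are used like de Bruijn environments, position 0 being the innermost
    binder. *)
Lemma pt_nth i : pt vs (nth (fun=> Leaf) vs i).
Proof.
case: (ltnP i (size vs)) => Hi; last by apply: pt_ext pt_nil => a; rewrite nth_default.
have [d Hd]: bd vs (fun a => (inp vs a).+1) by apply/bd_S/bd_inp.
exists (fun r m => Assign m (Var (nth 0 r i))), d => a r m s Hr Hs.
have E : s (nth 0 r i) = nth (fun=> Leaf) vs i a.
  have Hi' : i < size r by rewrite -(size_map s) Hs size_map.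
  by rewrite -(nth_map 0 (s 0)) // Hs (nth_map (fun=> Leaf)).
exists (cost s (Var (nth 0 r i))).+1, (upd s m (eval s (Var (nth 0 r i)))).
split=> [||j jm|]; first exact: ExecAssign.
- by rewrite /upd eqxx /= E.
- by rewrite /upd ltn_eqF.
apply: leq_trans (Hd a); rewrite /= E ltnS /inp.
suff: tree_size (nth (fun=> Leaf) vs i a) <= \sum_(v <- vs) tree_size (v a) by lia.
elim: vs i Hi {Hs E Hd} => [|v l IH] [|i] //=; rewrite big_cons; first by lia.
by move/IH; lia.
Qed.

Lemma pt_if (c : A -> bool) f g :
  pt vs (fun a => enc_bool (c a)) -> pt vs f -> pt vs g ->
  pt vs (fun a => if c a then f a else g a).
Proof.
move=> Hc Hf Hg; have Bc := pt_bd Hc; have Bf := pt_bd Hf; have Bg := pt_bd Hg.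
case: Hc Hf Hg => Fc [dc Hc] [Ff [df Hf]] [Fg [dg Hg]].
have [d Hd]: bd vs (fun a => inp vs a ^ dc + inp vs a ^ df + inp vs a ^ dg + 20).
  by do ![exact: bd_const | exact: bd_inp | apply: bd_exp | apply: bd_add].
exists (fun r m => Seq (Fc r m) (If (Var m) (Ff r m) (Fg r m))), d => a r m s Hr Hs.
have [n [s' [Hx Hm Hi Hn]]] := Hc a r m s Hr Hs.
have Hs' : [seq s' i | i <- r] = [seq v a | v <- vs] by rewrite (map_agree Hi Hr).
case E: (c a) Hm => Hm.
- have [n' [s2 [Hx' Hm' Hi' Hn']]] := Hf a r m s' Hr Hs'.
  exists (n + (cost s' (Var m) + n').+1).+1, s2; split=> //.
  + by apply: ExecSeq Hx _; apply: ExecIfTrue => //=; rewrite Hm.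
  + by move=> i im; rewrite Hi' ?Hi.
  + by apply: leq_trans (Hd a); rewrite /= Hm /=; lia.
- have [n' [s2 [Hx' Hm' Hi' Hn']]] := Hg a r m s' Hr Hs'.
  exists (n + (cost s' (Var m) + n').+1).+1, s2; split=> //.
  + by apply: ExecSeq Hx _; apply: ExecIfFalse => //=; rewrite Hm.
  + by move=> i im; rewrite Hi' ?Hi.
  + by apply: leq_trans (Hd a); rewrite /= Hm /=; lia.
Qed.

(** No tree encoding of [h a] as a whole is required, only of its components [w (h a)]. This allows
    Rocq types such as tuples and records as contexts. *)
Lemma pt_comp B (ws : seq (B -> tree)) (h : A -> B) (g : B -> tree) :
  pts vs [seq (fun a => w (h a)) | w <- ws] -> pt ws g -> pt vs (fun a => g (h a)).
Proof.
move=> Hws Hg; have [F [q [Hq]]] := pts_exec Hws; rewrite size_map => HF.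
have Hb : bd vs (fun a => inp ws (h a)).
  by do 2!apply: bd_S; apply: bd_le (bd_pts Hws) => a; rewrite big_map.
have Hgb := bd_comp Hb (pt_bd Hg); case: Hg => G [d HG].
have [e He]: bd vs (fun a => q a + inp ws (h a) ^ d + tree_size (g (h a)) + 20).
  do ![exact: bd_const | exact: Hb | exact: Hq | exact: Hgb | apply: bd_add | apply:
      bd_exp].
exists (fun r m => Seq (F r m) (Seq (G (iota m (size ws)) (m + size ws))
                     (Assign m (Var (m + size ws))))), e => a r m s Hr Hs.
have [n [s' [Hx Hm Hi Hn]]] := HF a r m s Hr Hs.
have [||n' [s2 [Hx' Hm' Hi' Hn']]] := HG (h a) (iota m (size ws)) (m + size ws) s'.
- by apply/allP => i; rewrite mem_iota => /andP[].
- by rewrite Hm -map_comp.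
exists (n + (n' + (tree_size (g (h a))).+1).+1).+1, (upd s2 m (g (h a))); split.
- apply: ExecSeq Hx _; apply: ExecSeq Hx' _; rewrite -Hm'.
  exact: (ExecAssign s2 m (Var (m + size ws))).
- by rewrite /upd eqxx.
- by move=> i im; rewrite /upd ltn_eqF // Hi' ?Hi // ltn_addr.
- by apply: leq_trans (He a); lia.
Qed.

End Closure.

(** * Loops over lists *)

Definition enc_list D (ed : D -> tree) (l : seq D) : tree := enc_seq (map ed l).

(* The context of a loop body: one more variable, of type [D], in front of [vs]. *)
Definition bnd A D (ed : D -> tree) (vs : seq (A -> tree)) :
  seq (A * D -> tree) := (fun p => ed p.2) :: [seq (fun p => v p.1) | v <- vs].

Lemma inp_bnd A D (ed : D -> tree) (vs : seq (A -> tree)) a x :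
  inp (bnd ed vs) (a, x) = tree_size (ed x) + inp vs a.
Proof. by rewrite /inp big_cons big_map !addnS. Qed.

Lemma pts_nth A (vs us ws : seq (A -> tree)) : vs = us ++ ws -> pts vs ws.
Proof.
elim: ws us => //= w ws IH us E; split; last first.
  by apply: (IH (rcons us w)); rewrite cat_rcons.
have -> : w = nth (fun=> Leaf) vs (size us) by rewrite E nth_cat ltnn subnn.
exact: pt_nth.
Qed.

Lemma pt_weak A D (ed : D -> tree) (vs : seq (A -> tree)) f :
  pt vs f -> pt (bnd ed vs) (fun p => f p.1).
Proof. by apply: pt_comp; apply: (@pts_nth _ _ [:: fun p => ed p.2]). Qed.

Lemma bd_weak A D (ed : D -> tree) (vs : seq (A -> tree)) q :
  bd vs q -> bd (bnd ed vs) (fun p => q p.1).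
Proof.
move=> [d H]; exists d => -[a x]; apply: leq_trans (H a) _ => /=.
by case: d {H} => // d; rewrite leq_exp2r // inp_bnd leq_addl.
Qed.

Section Fold.
Variables (A D C : Type) (vs : seq (A -> tree)).
Variables (ed : D -> tree) (ec : C -> tree).
Variables (l : A -> seq D) (i : A -> C) (b : A -> C -> D -> C).

(** The bound [q] on the accumulator over all prefixes of the list makes every iteration polynomial
    in the original input; the number of iterations is at most the size of the list. *)
Lemma pt_foldl_bd (q : A -> nat) :
  pt vs (fun a => enc_list ed (l a)) -> pt vs (fun a => ec (i a)) ->
  pt (bnd ed (bnd ec vs)) (fun p => ec (b p.1.1 p.1.2 p.2)) ->
  bd vs q ->
  (forall a l1 l2, l a = l1 ++ l2 ->
     tree_size (ec (foldl (b a) (i a) l1)) <= q a) ->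
  pt vs (fun a => ec (foldl (b a) (i a) (l a))).
Proof.
move=> Hl Hi Hb Hq Hacc.
have Bl := pt_bd Hl; case: Hl => Fl [dl Hl]; case: Hi => Fi [di Hi].
case: Hb => Fb [db Hb].
(* [nb] bounds one run of the body: the current element is no larger than the whole list and the
   accumulator has size at most [q a]. [w] adds the copying around the body. *)
pose nb a := (tree_size (enc_list ed (l a)) + (q a + inp vs a)) ^ db.
pose w a := 3 * tree_size (enc_list ed (l a)) + nb a + q a + 12.
have Hnb : bd vs nb.
  by apply/bd_exp; do ![exact: Bl | exact: Hq | exact: bd_inp | apply: bd_add].
have Hw : bd vs w.
  do ![exact: bd_const | exact: Hnb | exact: Bl | exact: Hq | apply: bd_add | apply:
      bd_mul].
have [d Hdd]: bd vs (fun a => inp vs a ^ dl + inp vs a ^ di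
                     + (tree_size (enc_list ed (l a))).+1 * w a + q a + 20).
  do ![exact: bd_const | exact: Bl | exact: Hq | exact: Hw | exact: bd_inp
      | apply: bd_exp | apply: bd_S | apply: bd_add | apply: bd_mul].
(* Register [m] holds the rest of the list, [m.+1] the accumulator, [m.+2] the current element and
   [m.+3] the result of the body. *)
pose bdy r m := Seq (Assign m.+2 (Hd (Var m)))
  (Seq (Fb (m.+2 :: m.+1 :: r) m.+3)
    (Seq (Assign m.+1 (Var m.+3)) (Assign m (Tl (Var m))))).
have loop a r m : all (gtn m) r -> forall l2 l1 s, l a = l1 ++ l2 ->
    [seq s j | j <- r] = [seq v a | v <- vs] ->
    s m = enc_list ed l2 -> s m.+1 = ec (foldl (b a) (i a) l1) ->
    exists n s', [/\ exec (While (Var m) (bdy r m)) s n s',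
      s' m.+1 = ec (foldl (b a) (i a) (l a)), forall j, j < m -> s' j = s j
      & n <= (size l2).+1 * w a].
  move=> Hr; elim=> [|x l2 IH] l1 s El Hs Hm Hm1.
    exists (cost s (Var m)).+1, s; split=> //.
    - by apply: ExecWhileFalse; rewrite /= Hm.
    - by rewrite El cats0.
    - by rewrite /= Hm /= /w; lia.
  have szl : tree_size (s m) <= tree_size (enc_list ed (l a)).
    rewrite El Hm /enc_list map_cat.
    elim: (map ed l1) => //= y u IHu; lia.
  pose s1 := upd s m.+2 (ed x).
  have s1r : [seq s1 j | j <- r] = [seq v a | v <- vs].
    by rewrite -Hs; apply: map_agree Hr => j jm; rewrite /s1 /upd ltn_eqF //; lia.
  have [||nb' [s2 [Hx2 Hm2 Hj2 Hn2]]] :=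
    Hb ((a, foldl (b a) (i a) l1), x) (m.+2 :: m.+1 :: r) m.+3 s1.
  - by rewrite /= ltnSn ltnS leqnSn /=; apply: all_gtnW Hr; lia.
  - rewrite /= -!map_comp /= s1r -Hm1; congr (_ :: _ :: _).
    + by rewrite /s1 /upd eqxx.
    + by rewrite /s1 /upd ltn_eqF.
  have {}Hn2 : nb' <= nb a.
    apply: leq_trans Hn2 _; rewrite !inp_bnd /nb.
    case: (db) => // e; rewrite leq_exp2r // leq_add //.
      by apply: leq_trans szl; rewrite Hm /=; lia.
    by rewrite leq_add2r; apply: Hacc El.
  pose s3 := upd s2 m.+1 (s2 m.+3); pose s4 := upd s3 m (ttl (s3 m)).
  have s2m : s2 m = s m by rewrite Hj2 /s1 /upd ?ltn_eqF //; lia.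
  have s3m : s3 m = s m by rewrite -s2m /s3 /upd ltn_eqF.
  have sacc : tree_size (s2 m.+3) <= q a.
    rewrite Hm2 /= -foldl_rcons; apply: Hacc; rewrite El -cat_rcons; reflexivity.
  have Hj4 j : j < m -> s4 j = s j.
    by move=> jm; rewrite /s4 /s3 /upd !ltn_eqF ?Hj2 /s1 /upd ?ltn_eqF //; lia.
  have [||||n [s5 [Hx5 Hm5 Hj5 Hn5]]] := IH (rcons l1 x) s4.
  - by rewrite cat_rcons.
  - by rewrite (map_agree Hj4 Hr).
  - by rewrite /s4 /upd eqxx s3m Hm.
  - by rewrite /s4 /upd gtn_eqF // /s3 /upd eqxx Hm2 foldl_rcons.
  have Hbdy : exec (bdy r m) s
      ((cost s (Hd (Var m))).+1 +
       (nb' + ((cost s2 (Var m.+3)).+1 + (cost s3 (Tl (Var m))).+1).+1).+1).+1 s4.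
    apply: (ExecSeq (s2 := s1)).
      have -> : s1 = upd s m.+2 (eval s (Hd (Var m))) by rewrite /= Hm.
      exact: ExecAssign.
    apply: ExecSeq Hx2 _; apply: ExecSeq; first exact: ExecAssign.
    exact: (ExecAssign s3 m (Tl (Var m))).
  eexists; exists s5; split.
  - by apply: ExecWhileTrue Hbdy Hx5; rewrite /= Hm.
  - by [].
  - by move=> j jm; rewrite Hj5 ?Hj4.
  - by rewrite /= s3m mulSn; rewrite /w in Hn5 *; lia.
exists (fun r m => Seq (Fl r m) (Seq (Fi r m.+1) (Seq (While (Var m) (bdy r m))
   (Assign m (Var m.+1))))), d => a r m s Hr Hs.
have [n1 [s1 [Hx1 Hm1 Hj1 Hn1]]] := Hl a r m s Hr Hs.
have [|n2 [s2 [Hx2 Hm2 Hj2 Hn2]]] := Hi a r m.+1 s1 (all_gtnW (leqnSn m) Hr).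
  by rewrite (map_agree Hj1 Hr).
have [||||n3 [s3 [Hx3 Hm3 Hj3 Hn3]]] := loop a r m Hr (l a) [::] s2 => //.
- rewrite -Hs -(map_agree Hj1 Hr); apply: map_agree Hr => j jm.
  by rewrite Hj2 // ltnW.
- by rewrite Hj2.
eexists; exists (upd s3 m (s3 m.+1)); split.
- apply: ExecSeq Hx1 _; apply: ExecSeq Hx2 _; apply: ExecSeq Hx3 _.
  exact: (ExecAssign s3 m (Var m.+1)).
- by rewrite /upd eqxx.
- by move=> j jm; rewrite /upd ltn_eqF // Hj3 // Hj2 ?Hj1 // ltnW.
apply: leq_trans (Hdd a); rewrite /= Hm3.
have := Hacc a (l a) [::]; rewrite cats0 => /(_ erefl).
have: (size (l a)).+1 * w a <= (tree_size (enc_list ed (l a))).+1 * w a.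
  by rewrite leq_mul2r ltnS ltnW ?orbT // -(size_map ed) size_enc_seq.
lia.
Qed.

(** If each step adds an amount that does not depend on the accumulator, growth is linear in the
    number of steps. Since every element is no larger than the list, these amounts have a common
    polynomial bound. *)
Lemma pt_foldl (q : A -> D -> nat) :
  pt vs (fun a => enc_list ed (l a)) -> pt vs (fun a => ec (i a)) ->
  pt (bnd ed (bnd ec vs)) (fun p => ec (b p.1.1 p.1.2 p.2)) ->
  bd (bnd ed vs) (fun p => q p.1 p.2) ->
  (forall a c x, tree_size (ec (b a c x)) <= tree_size (ec c) + q a x) ->
  pt vs (fun a => ec (foldl (b a) (i a) (l a))).
Proof.
move=> Hl Hi Hb [d Hq] Hadd.
pose m a := tree_size (enc_list ed (l a)).
apply: (@pt_foldl_bd (fun a => tree_size (ec (i a)) + m a * (m a + inp vs a) ^ d)) =>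
    //.
  do ![exact: bd_inp | exact: pt_bd | apply: bd_exp | apply: bd_add | apply: bd_mul].
move=> a l1 l2 El.
have [sz1 mem1] : size l1 <= m a /\ forall l3 x l4, l1 = l3 ++ x :: l4 -> tree_size
    (ed x) <= m a.
  split.
    apply: leq_trans (ltnW (size_enc_seq _)); rewrite size_map El size_cat; lia.
  move=> l3 x l4 E; rewrite /m /enc_list El E -catA map_cat.
  elim: (map ed l3) => /= [|y u]; lia.
apply: leq_trans (_ : tree_size (ec (i a)) + size l1 * (m a + inp vs a) ^ d <= _);
    last first.
  by rewrite leq_add2l leq_mul2r sz1 orbT.
elim/last_ind: l1 {El sz1} mem1 => [|l1 x IH] mem1 /=; first by lia.
rewrite foldl_rcons size_rcons; apply: leq_trans (Hadd _ _ _) _.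
have {}IH : tree_size (ec (foldl (b a) (i a) l1))
    <= tree_size (ec (i a)) + size l1 * (m a + inp vs a) ^ d.
  by apply: IH => l3 y l4 E; apply: (mem1 l3 y (rcons l4 x)); rewrite E rcons_cat.
have: q a x <= (m a + inp vs a) ^ d.
  apply: leq_trans (Hq (a, x)) _; rewrite inp_bnd; case: (d) => // e.
  by rewrite leq_exp2r // leq_add2r; apply: (mem1 l1 x [::]); rewrite cats1.
lia.
Qed.

End Fold.

Lemma pt_weak2 A D C (ed : D -> tree) (ec : C -> tree) (vs : seq (A -> tree)) f :
  pt vs f -> pt (bnd ed (bnd ec vs)) (fun p => f p.1.1).
Proof. by move=> H; apply: (@pt_weak _ _ _ _ (fun p => f p.1)); apply: pt_weak. Qed.

(** * Lists, booleans and unary arithmetic *)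

Lemma pt_const A (vs : seq (A -> tree)) t : pt vs (fun=> t).
Proof. by elim: t => [|t1 IH1 t2 IH2]; [apply: pt_nil | apply: pt_cons]. Qed.

Lemma pt_rev A (vs : seq (A -> tree)) D (ed : D -> tree) (l : A -> seq D) :
  pt vs (fun a => enc_list ed (l a)) -> pt vs (fun a => enc_list ed (rev (l a))).
Proof.
move=> Hl; have E D' (u v : seq D') : foldl (fun c x => x :: c) v u = catrev u v.
  by elim: u v => //= x u IH v; rewrite IH.
apply: (pt_ext (f := fun a => enc_list ed (foldl (fun c x => x :: c) [::] (l a)))).
  by move=> a; rewrite E.
apply: (pt_foldl (ed := ed) (q := fun _ x => (tree_size (ed x)).+1)) => //.
- exact: pt_nil.
- apply: (pt_cons (f := fun p => ed p.2) (g := fun p => enc_list ed p.1.2)).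
    exact: (pt_nth _ 0).
  exact: (pt_nth _ 1).
- by apply: bd_S; apply: (pt_bd (pt_nth (bnd ed vs) 0)).
- by move=> a c x; rewrite /= -/(enc_list ed c); lia.
Qed.

Lemma pt_foldr A (vs : seq (A -> tree)) D C (ed : D -> tree) (ec : C -> tree) (l : A
    -> seq D)
    (i : A -> C) (b : A -> D -> C -> C) (q : A -> D -> nat) :
  pt vs (fun a => enc_list ed (l a)) -> pt vs (fun a => ec (i a)) ->
  pt (bnd ed (bnd ec vs)) (fun p => ec (b p.1.1 p.2 p.1.2)) ->
  bd (bnd ed vs) (fun p => q p.1 p.2) ->
  (forall a c x, tree_size (ec (b a x c)) <= tree_size (ec c) + q a x) ->
  pt vs (fun a => ec (foldr (b a) (i a) (l a))).
Proof.
move=> Hl Hi Hb Hq Hadd.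
apply: (pt_ext (f := fun a => ec (foldl (fun c x => b a x c) (i a) (rev (l a))))).
  by move=> a; rewrite foldl_rev.
exact: (pt_foldl (pt_rev Hl) Hi Hb Hq).
Qed.

(** Weakening by an accumulator in the middle of the context, for loop bodies that ignore it in part
    of their work. *)
Lemma pt_skip A (vs : seq (A -> tree)) D C (ed : D -> tree) (ec : C -> tree) (f : A
    -> D -> tree) :
  pt (bnd ed vs) (fun p => f p.1 p.2) ->
  pt (bnd ed (bnd ec vs)) (fun p => f p.1.1 p.2).
Proof.
apply: (pt_comp (h := fun p : A * C * D => (p.1.1, p.2))); split.
  exact: (pt_nth _ 0).
rewrite -map_comp.
apply: (@pts_nth _ _ [:: fun p => ed p.2; fun p => ec p.1.2]).
by rewrite /bnd /= -map_comp.
Qed.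

Lemma pt_map A (vs : seq (A -> tree)) D (ed : D -> tree) (l : A -> seq D) (f : A -> D
    -> tree) :
  pt vs (fun a => enc_list ed (l a)) -> pt (bnd ed vs) (fun p => f p.1 p.2) ->
  pt vs (fun a => enc_seq (map (f a) (l a))).
Proof.
move=> Hl Hf.
apply: (pt_ext (f := fun a => enc_seq (foldr (fun x c => f a x :: c) [::] (l a)))).
  by move=> a; congr enc_seq; elim: (l a) => //= x u ->.
apply: (pt_foldr (ed := ed) (q := fun a x => (tree_size (f a x)).+1)) => //.
- exact: pt_nil.
- apply: (pt_cons (g := fun p => enc_seq p.1.2)); first exact: pt_skip.
  exact: (pt_nth _ 1).
- by apply: bd_S; apply: (pt_bd Hf).
- by move=> a c x /=; lia.
Qed.

Lemma pt_filter A (vs : seq (A -> tree)) D (ed : D -> tree) (l : A -> seq D) (p : A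
    -> D -> bool) :
  pt vs (fun a => enc_list ed (l a)) ->
  pt (bnd ed vs) (fun x => enc_bool (p x.1 x.2)) ->
  pt vs (fun a => enc_list ed (filter (p a) (l a))).
Proof.
move=> Hl Hp; apply: (pt_ext (f := fun a => enc_list ed
    (foldr (fun x c => if p a x then x :: c else c) [::] (l a)))).
  by move=> a; congr enc_list; elim: (l a) => //= x u ->.
apply: (pt_foldr (ed := ed) (ec := enc_list ed)
  (b := fun a x c => if p a x then x :: c else c)
  (q := fun a x => (tree_size (ed x)).+1)) => //.
- exact: pt_nil.
- apply: (pt_ext (f := fun x => if p x.1.1 x.2 then Node (ed x.2) (enc_list ed x.1.2)
    else enc_list ed x.1.2)).
    by move=> [[a c] x] /=; case: ifP.
  apply: pt_if; last exact: (pt_nth _ 1).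
    exact: (pt_skip (enc_list ed) (f := fun a x => enc_bool (p a x))).
  by apply: pt_cons; [exact: (pt_nth _ 0) | exact: (pt_nth _ 1)].
- by apply: bd_S; apply: (pt_bd (pt_nth (bnd ed vs) 0)).
- by move=> a c x; case: ifP => _ //=; rewrite -/(enc_list ed c); lia.
Qed.

Lemma pt_cat A (vs : seq (A -> tree)) D (ed : D -> tree) (l l' : A -> seq D) :
  pt vs (fun a => enc_list ed (l a)) -> pt vs (fun a => enc_list ed (l' a)) ->
  pt vs (fun a => enc_list ed (l a ++ l' a)).
Proof.
move=> Hl Hl'; apply: (pt_ext (f := fun a => enc_list ed (foldr cons (l' a) (l a)))).
  by move=> a; congr enc_list; elim: (l a) => //= x u ->.
apply: (pt_foldr (ed := ed) (ec := enc_list ed)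
  (b := fun a x c => x :: c) (q := fun a x => (tree_size (ed x)).+1)) => //.
- by apply: pt_cons; [exact: (pt_nth _ 0) | exact: (pt_nth _ 1)].
- by apply: bd_S; apply: (pt_bd (pt_nth (bnd ed vs) 0)).
- by move=> a c x /=; rewrite -/(enc_list ed c); lia.
Qed.

Lemma pt_or A (vs : seq (A -> tree)) (b c : A -> bool) :
  pt vs (fun a => enc_bool (b a)) -> pt vs (fun a => enc_bool (c a)) ->
  pt vs (fun a => enc_bool (b a || c a)).
Proof.
move=> Hb Hc; apply: (pt_ext (f := fun a => if b a then enc_bool true else enc_bool
    (c a))).
  by move=> a; case: (b a).
by apply: pt_if => //; apply: pt_const.
Qed.

Lemma pt_neg A (vs : seq (A -> tree)) (b : A -> bool) :
  pt vs (fun a => enc_bool (b a)) -> pt vs (fun a => enc_bool (~~ b a)).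
Proof.
move=> Hb; apply: (pt_ext (f := fun a => if b a then enc_bool false else enc_bool
    true)).
  by move=> a; case: (b a).
by apply: pt_if => //; apply: pt_const.
Qed.

Lemma pt_mem A (vs : seq (A -> tree)) (f : A -> tree) (l : A -> seq tree) :
  pt vs f -> pt vs (fun a => enc_list id (l a)) ->
  pt vs (fun a => enc_bool (f a \in l a)).
Proof.
move=> Hf Hl.
apply: (pt_ext (f := fun a => enc_bool (foldr (fun x c => (f a == x) || c) false (l
    a)))).
  by move=> a; congr enc_bool; elim: (l a) => //= x u ->.
apply: (pt_foldr (ed := id) (q := fun _ _ => 2)) => //.
- exact: pt_const.
- apply: pt_or; last exact: (pt_nth _ 1).
  by apply: pt_eq; [exact: pt_weak2 | exact: (pt_nth _ 0)].
- exact: bd_const.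
- by move=> a c x; have := tree_size_gt0 (enc_bool c); case: (_ || _) => /=; lia.
Qed.

Lemma pt_undup A (vs : seq (A -> tree)) (l : A -> seq tree) :
  pt vs (fun a => enc_list id (l a)) -> pt vs (fun a => enc_list id (undup (l a))).
Proof.
move=> Hl; apply: (pt_ext (f := fun a => enc_list id
    (foldr (fun x c => if x \in c then c else x :: c) [::] (l a)))).
  move=> a; congr enc_list; elim: (l a) => //= x u ->; by rewrite mem_undup.
apply: (pt_foldr (ed := id) (q := fun _ x => (tree_size x).+1)) => //.
- exact: pt_nil.
- apply: (pt_ext (f := fun x => if x.2 \in x.1.2 then enc_list id x.1.2 else Node x.2
    (enc_list id x.1.2))).
    by move=> [[a c] x] /=; case: ifP.
  apply: pt_if; last by apply: pt_cons; [exact: (pt_nth _ 0) | exact: (pt_nth _ 1)].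
    by apply: pt_mem; [exact: (pt_nth _ 0) | exact: (pt_nth _ 1)].
  exact: (pt_nth _ 1).
- by apply: bd_S; apply: (pt_bd (pt_nth (bnd id vs) 0)).
- by move=> a c x; case: ifP => _ //=; rewrite -/(enc_list id c); lia.
Qed.

Lemma pt_size A (vs : seq (A -> tree)) D (ed : D -> tree) (l : A -> seq D) :
  pt vs (fun a => enc_list ed (l a)) -> pt vs (fun a => enc_nat (size (l a))).
Proof.
move=> Hl; apply: (pt_ext (f := fun a => enc_nat (foldr (fun _ c => c.+1) 0 (l a)))).
  by move=> a; congr enc_nat; elim: (l a) => //= x u ->.
apply: (pt_foldr (ed := ed) (q := fun _ _ => 2)) => //.
- exact: pt_nil.
- by apply: pt_cons; [exact: pt_nil | exact: (pt_nth _ 1)].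
- exact: bd_const.
- by move=> a c x; rewrite !tree_size_nat; lia.
Qed.

Lemma pt_index A (vs : seq (A -> tree)) (f : A -> tree) (l : A -> seq tree) :
  pt vs f -> pt vs (fun a => enc_list id (l a)) ->
  pt vs (fun a => enc_nat (index (f a) (l a))).
Proof.
move=> Hf Hl.
apply: (pt_ext (f := fun a => enc_nat (foldr (fun x c => if x == f a then 0 else
    c.+1) 0 (l a)))).
  by move=> a; congr enc_nat; elim: (l a) => //= x u ->.
apply: (pt_foldr (ed := id) (q := fun _ _ => 2)) => //.
- exact: pt_nil.
- apply: (pt_ext (f := fun x => if x.2 == f x.1.1 then Leaf else Node Leaf (enc_nat
    x.1.2))).
    by move=> [[a c] x] /=; case: ifP.
  apply: pt_if; first by apply: pt_eq; [exact: (pt_nth _ 0) | exact: pt_weak2].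
    exact: pt_nil.
  by apply: pt_cons; [exact: pt_nil | exact: (pt_nth _ 1)].
- exact: bd_const.
- by move=> a c x; case: ifP => _; rewrite !tree_size_nat; lia.
Qed.

(** A unary numeral is itself the code of a list of [n] leaves, so iteration is a fold over it. *)
Lemma pt_iter A (vs : seq (A -> tree)) C (ec : C -> tree) (n : A -> nat) (i : A -> C)
    (b : A -> C -> C) (q : A -> nat) :
  pt vs (fun a => enc_nat (n a)) -> pt vs (fun a => ec (i a)) ->
  pt (bnd ec vs) (fun p => ec (b p.1 p.2)) -> bd vs q ->
  (forall a c, tree_size (ec (b a c)) <= tree_size (ec c) + q a) ->
  pt vs (fun a => ec (iter (n a) (b a) (i a))).
Proof.
move=> Hn Hi Hb Hq Hadd.
apply: (pt_ext (f := fun a => ec (foldr (fun (x : tree) c => b a c) (i a) (nseq (n a)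
    Leaf)))).
  by move=> a; congr ec; elim: (n a) => //= m ->.
apply: (pt_foldr (ed := id) (ec := ec) (b := fun a _ c => b a c) (q := fun a _ => q
    a)) => //.
- by apply: pt_ext Hn => a; rewrite /enc_list map_id.
- by apply: (pt_weak id Hb).
- exact: bd_weak.
Qed.

Lemma pt_nth_seq A (vs : seq (A -> tree)) (n : A -> nat) (l : A -> seq tree) :
  pt vs (fun a => enc_nat (n a)) -> pt vs (fun a => enc_list id (l a)) ->
  pt vs (fun a => nth Leaf (l a) (n a)).
Proof.
move=> Hn Hl.
apply: (pt_ext (f := fun a => thd (enc_list id (iter (n a) behead (l a))))).
  by move=> a; elim: (n a) (l a) => [|m IH] [|x u] //=; rewrite -?iterS ?iterSr ?IH
      //= ?nth_nil.
apply: pt_hd; apply: (pt_iter (b := fun _ => behead) (q := fun=> 0)) => //.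
- apply: (pt_ext (f := fun p => ttl (enc_list id p.2))); first by case=> a [].
  by apply: pt_tl; exact: (pt_nth _ 0).
- exact: bd_const.
- by move=> a [|x u] //=; rewrite -/(enc_list id u); lia.
Qed.

(** Truncated subtraction is iterated [predn], and [m < n] holds exactly when [n - m] is nonzero. *)
Lemma pt_ltn A (vs : seq (A -> tree)) (m n : A -> nat) :
  pt vs (fun a => enc_nat (m a)) -> pt vs (fun a => enc_nat (n a)) ->
  pt vs (fun a => enc_bool (m a < n a)).
Proof.
move=> Hm Hn.
apply: (pt_ext (f := fun a => enc_bool (~~ (enc_nat (iter (m a) predn (n a)) ==
    Leaf)))).
  move=> a; have -> : iter (m a) predn (n a) = n a - m a.
    by elim: (m a) => [|k IH]; rewrite ?subn0 //= IH subnS.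
  by rewrite -subn_gt0; case: (n a - m a).
apply/pt_neg/pt_eq; last exact: pt_nil.
apply: (pt_iter (b := fun _ => predn) (q := fun=> 0)) => //.
- apply: (pt_ext (f := fun p => ttl (enc_nat p.2))); first by case=> a [].
  by apply: pt_tl; exact: (pt_nth _ 0).
- exact: bd_const.
- by move=> a c; rewrite !tree_size_nat; lia.
Qed.

Lemma pt_addn A (vs : seq (A -> tree)) (m n : A -> nat) :
  pt vs (fun a => enc_nat (m a)) -> pt vs (fun a => enc_nat (n a)) ->
  pt vs (fun a => enc_nat (m a + n a)).
Proof.
move=> Hm Hn; apply: (pt_ext (f := fun a => enc_nat (iter (m a) succn (n a)))).
  by move=> a; rewrite iter_succn addnC.
apply: (pt_iter (b := fun _ => succn) (q := fun=> 2)) => //.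
- by apply: pt_cons; [exact: pt_nil | exact: (pt_nth _ 0)].
- exact: bd_const.
- by move=> a c; rewrite !tree_size_nat; lia.
Qed.

Lemma pt_muln A (vs : seq (A -> tree)) (m n : A -> nat) :
  pt vs (fun a => enc_nat (m a)) -> pt vs (fun a => enc_nat (n a)) ->
  pt vs (fun a => enc_nat (m a * n a)).
Proof.
move=> Hm Hn; apply: (pt_ext (f := fun a => enc_nat (iter (m a) (addn (n a)) 0))).
  by move=> a; rewrite iter_addn_0 mulnC.
apply: (pt_iter (b := fun a => addn (n a)) (q := fun a => tree_size (enc_nat (n a))))
    => //.
- exact: pt_nil.
- by apply: pt_addn; [exact: (@pt_weak _ _ _ _ (fun a => enc_nat (n a))) | exact:
    (pt_nth _ 0)].
- exact: pt_bd.
- by move=> a c; rewrite !tree_size_nat; lia.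
Qed.

Lemma pt_expn A (vs : seq (A -> tree)) (m : A -> nat) d :
  pt vs (fun a => enc_nat (m a)) -> pt vs (fun a => enc_nat (m a ^ d)).
Proof.
move=> Hm; elim: d => [|d IH]; first exact: pt_const.
by apply: (pt_ext (f := fun a => enc_nat (m a * m a ^ d))) (pt_muln Hm IH) => a;
    rewrite expnS.
Qed.

(** The descending order lets each step push the successor of the current head. The growth of a step
    depends on that head, hence on the accumulator, so the general [pt_foldl_bd] is needed. *)
Lemma pt_iota A (vs : seq (A -> tree)) (n : A -> nat) :
  pt vs (fun a => enc_nat (n a)) ->
  pt vs (fun a => enc_list enc_nat (rev (iota 0 (n a).+1))).
Proof.
move=> Hn; have E k : rev (iota 0 k.+1) = iter k (fun c => (head 0 c).+1 :: c) [:: 0].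
  have S m : rev (iota 0 m.+1) = m :: rev (iota 0 m).
    by rewrite -addn1 iotaD cats1 rev_rcons.
  by elim: k => // k IH; rewrite iterS -IH !S.
have E2 k : iter k (fun c => (head 0 c).+1 :: c) [:: 0]
    = foldl (fun c (_ : tree) => (head 0 c).+1 :: c) [:: 0] (nseq k Leaf).
  by elim: k {E} [:: 0] => //= k IH c; rewrite -IH -iterSr.
apply: (pt_ext (f := fun a => enc_list enc_nat (foldl (fun c (_ : tree) =>
   (head 0 c).+1 :: c) [:: 0] (nseq (n a) Leaf)))) => [a|]; first by rewrite E E2.
apply: (pt_foldl_bd (ed := id) (ec := enc_list enc_nat)
  (q := fun a => ((n a).+1 * (tree_size (enc_nat (n a))).+1).+1)).
- by apply: pt_ext Hn => a; rewrite /enc_list map_id.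
- exact: pt_const.
- apply: (pt_ext (f := fun p => Node (Node Leaf (thd (enc_list enc_nat p.1.2)))
    (enc_list enc_nat p.1.2))).
    by move=> [[a [|y c]] x].
  apply: pt_cons; last exact: (pt_nth _ 1).
  by apply: pt_cons; [exact: pt_nil | apply: pt_hd; exact: (pt_nth _ 1)].
- apply/bd_S/bd_mul; last by apply/bd_S/pt_bd.
  by apply: bd_S; apply: bd_le (pt_bd Hn) => a; rewrite tree_size_nat; lia.
move=> a l1 l2 El.
have sz : size l1 <= n a by rewrite -(size_nseq (n a) Leaf) El size_cat leq_addr.
have -> : l1 = nseq (size l1) Leaf.
  apply/all_pred1P/allP => x xl; have : x \in nseq (n a) Leaf by rewrite El mem_cat xl.
  by rewrite mem_nseq => /andP[].
rewrite -E2 -E; apply: leq_trans (tree_size_le_seq (n := tree_size (enc_nat (n a)))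
    _) _.
  move=> _ /mapP[j + ->]; rewrite mem_rev mem_iota !tree_size_nat; lia.
by rewrite size_map size_rev size_iota ltnS leq_mul2r; apply/orP; right; lia.
Qed.

(** * The kernelization algorithm *)

(** Edges are stored in one orientation only, hence the two symmetric parts. Repetitions are kept: a
    step lengthens the list by at most twice the length of [E], an additive bound as loops
    require. *)
Definition step (E R : seq tree) : seq tree :=
  [seq ttl e | e <- E & thd e \in R] ++ [seq thd e | e <- E & ttl e \in R] ++ R.

Definition reach (E : seq tree) (x : tree) (j : nat) : seq tree :=
  iter j (step E) [:: x].

(** All the distance information in one tree, so that a single equality test decides whether a
    deletion is harmless. *)
Definition dist_table (E X : seq tree) (k : nat) : tree :=
  enc_seq [seq enc_seq [seq enc_seq [seq enc_bool (y \in reach E x j) | y <- X]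
                       | j <- rev (iota 0 k.+1)] | x <- X].

Definition prune (X : seq tree) (k : nat) (E : seq tree) : seq tree :=
  foldl (fun E' e => if dist_table (filter (predC1 e) E') X k == dist_table E' X k
                     then filter (predC1 e) E' else E') E E.

Definition ends (E : seq tree) : seq tree := map thd E ++ map ttl E.

(** An edge of [G_f] is a pair of edges of G, so [ends fs] lists the forced edges, and [ends]
    applied once more lists their endpoints. *)
Definition kernel_edges (es fs : seq tree) (s t : tree) (k : nat) : seq tree :=
  undup (ends fs) ++ prune [:: s, t & ends (undup (ends fs))] k
                       [seq e <- es | e \notin undup (ends fs)].

Definition kernel_vertices (E : seq tree) (s t : tree) : seq tree :=
  undup [:: s, t & ends E].

Definition enc_rel (vs es : seq tree) : tree :=
  enc_seq [seq Node (enc_nat (index (thd e) vs)) (enc_nat (index (ttl e) vs))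
          | e <- es].

Definition enc_inst (vs es fs : seq tree) (s t : tree) (k : nat) : tree :=
  enc_seq [:: enc_nat (size vs); enc_rel vs es; enc_rel es fs;
              enc_nat (index s vs); enc_nat (index t vs); enc_nat k].

(** Two isolated vertices as terminals. With no edges the forcing graph is empty, so this
    no-instance belongs to both classes. *)
Definition no_inst : tree :=
  enc_inst [:: Leaf; Node Leaf Leaf] [::] [::] Leaf (Node Leaf Leaf) 1.

Record input := Input {
  in_n : nat; in_es : seq tree; in_fs : seq (nat * nat);
  in_s : tree; in_t : tree; in_k : nat }.

Definition enc_pair (p : nat * nat) : tree := Node (enc_nat p.1) (enc_nat p.2).

Definition enc_input (x : input) : tree :=
  enc_seq [:: enc_nat (in_n x); enc_seq (in_es x); enc_list enc_pair (in_fs x);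
              in_s x; in_t x; enc_nat (in_k x)].

(** The input names edges by positions in a list that the kernelization shortens; replacing
    positions by the edges themselves makes the names stable. *)
Definition in_forcing (x : input) : seq tree :=
  [seq Node (nth Leaf (in_es x) f.1) (nth Leaf (in_es x) f.2) | f <- in_fs x].

Definition kernel (c : nat) (x : input) : tree :=
  let fs := in_forcing x in
  if c * in_k x < size (undup (ends fs)) then no_inst else
  let es := kernel_edges (in_es x) fs (in_s x) (in_t x) (in_k x) in
  enc_inst (kernel_vertices es (in_s x) (in_t x)) es fs (in_s x) (in_t x) (in_k x).

(** * The kernelization runs in polynomial time *)

Lemma pt_list A (vs : seq (A -> tree)) (l : A -> seq tree) :
  pt vs (fun a => enc_list id (l a)) <-> pt vs (fun a => enc_seq (l a)).
Proof. by split; apply: pt_ext => a; rewrite /enc_list map_id. Qed.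

Lemma pt_maps A (vs : seq (A -> tree)) (l : A -> seq tree) (f : tree -> tree) :
  pt vs (fun a => enc_list id (l a)) -> pt [:: id] f ->
  pt vs (fun a => enc_list id (map f (l a))).
Proof.
move=> Hl Hf; apply/pt_list/(pt_map (ed := id) (f := fun _ => f)) => //.
by apply: (pt_comp (h := snd) (ws := [:: id])) => //; split=> //; exact: (pt_nth _ 0).
Qed.

Lemma pt_thd : pt [:: id] thd.
Proof. by apply: pt_hd; exact: (pt_nth _ 0). Qed.

Lemma pt_ttl : pt [:: id] ttl.
Proof. by apply: pt_tl; exact: (pt_nth _ 0). Qed.

Lemma pt_ends A (vs : seq (A -> tree)) (l : A -> seq tree) :
  pt vs (fun a => enc_list id (l a)) -> pt vs (fun a => enc_list id (ends (l a))).
Proof.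
by move=> Hl; apply: pt_cat; apply: pt_maps => //; [exact: pt_thd | exact: pt_ttl].
Qed.

Lemma pt_reach A (vs : seq (A -> tree)) (E : A -> seq tree) (x : A -> tree)
    (j : A -> nat) :
  pt vs (fun a => enc_list id (E a)) -> pt vs x -> pt vs (fun a => enc_nat (j a)) ->
  pt vs (fun a => enc_list id (reach (E a) (x a) (j a))).
Proof.
move=> HE Hx Hj.
have szm f (p : pred tree) l : (forall e, tree_size (f e) <= tree_size e) ->
    tree_size (enc_list id [seq f e | e <- l & p e]) <= tree_size (enc_list id l).
  move=> Hf; elim: l => //= e l IH; case: ifP => _ /=; rewrite /enc_list /= in IH *;
    have := Hf e; lia.
apply: (pt_iter (b := fun a => step (E a)) (q := fun a => 2 * tree_size (enc_list id
    (E a)))) => //.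
- by apply: pt_cons => //; apply: pt_nil.
- have HE1 : pt (bnd (enc_list id) vs) (fun p => enc_list id (E p.1)).
    exact: (@pt_weak _ _ _ _ (fun a => enc_list id (E a))).
  have Hm f : pt [:: id] f -> pt (bnd id (bnd (enc_list id) vs)) (fun p => enc_bool
      (f p.2 \in p.1.2)).
    move=> Hf; apply: pt_mem; last exact: (pt_nth _ 1).
    by apply: (pt_comp (h := snd) (ws := [:: id])) => //; split=> //; exact: (pt_nth
        _ 0).
  apply: pt_cat; [|apply: pt_cat]; last exact: (pt_nth _ 0).
    apply: pt_maps pt_ttl; apply: (pt_filter (p := fun p e => thd e \in p.2)) => //.
    exact: Hm pt_thd.
  apply: pt_maps pt_thd; apply: (pt_filter (p := fun p e => ttl e \in p.2)) => //.
  exact: Hm pt_ttl.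
- by apply: bd_mul; [exact: bd_const | exact: pt_bd].
move=> a R; rewrite {1}/enc_list !map_cat -/(enc_list id R).
set u := map id _; set v := map id [seq thd e | e <- _ & _].
have Hu : tree_size (enc_seq u) <= tree_size (enc_list id (E a)) by apply: szm;
    case=> //= *; rewrite ltnW // ltnS ?leq_addr ?leq_addl.
have Hv : tree_size (enc_seq v) <= tree_size (enc_list id (E a)) by apply: szm;
    case=> //= *; rewrite ltnW // ltnS ?leq_addr ?leq_addl.
have := tree_size_cat u (v ++ map id R); have := tree_size_cat v (map id R).
by rewrite -/(enc_list id R); lia.
Qed.

Lemma pt_dist_table A (vs : seq (A -> tree)) (E X : A -> seq tree) (k : A -> nat) :
  pt vs (fun a => enc_list id (E a)) -> pt vs (fun a => enc_list id (X a)) ->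
  pt vs (fun a => enc_nat (k a)) ->
  pt vs (fun a => dist_table (E a) (X a) (k a)).
Proof.
move=> HE HX Hk.
apply: (pt_map (ed := id) (f := fun a x => enc_seq [seq enc_seq [seq enc_bool (y \in
    reach (E a) x j) | y <- X a] | j <- rev (iota 0 (k a).+1)])) => //.
apply: (pt_map (ed := enc_nat) (l := fun p => rev (iota 0 (k p.1).+1)) (f := fun p j
    => enc_seq [seq enc_bool (y \in reach (E p.1) p.2 j) | y <- X p.1])).
  by apply: (@pt_weak _ _ _ _ (fun a => enc_list enc_nat (rev (iota 0 (k a).+1))));
      apply: pt_iota.
apply: (pt_map (ed := id) (l := fun p => X p.1.1) (f := fun p y => enc_bool (y \in
    reach (E p.1.1) p.1.2 p.2))).
  exact: (@pt_weak2 _ _ _ _ _ _ (fun a => enc_list id (X a))).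
apply: pt_mem; first exact: (pt_nth _ 0).
apply: pt_reach; [|exact: (pt_nth _ 2)|exact: (pt_nth _ 1)].
apply: (@pt_weak _ _ _ _ (fun p => enc_list id (E p.1.1))).
exact: (@pt_weak2 _ _ _ _ _ _ (fun a => enc_list id (E a))).
Qed.

(** The accumulator only shrinks, hence the growth bound 0. *)
Lemma pt_prune A (vs : seq (A -> tree)) (E X : A -> seq tree) (k : A -> nat) :
  pt vs (fun a => enc_list id (E a)) -> pt vs (fun a => enc_list id (X a)) ->
  pt vs (fun a => enc_nat (k a)) ->
  pt vs (fun a => enc_list id (prune (X a) (k a) (E a))).
Proof.
move=> HE HX Hk.
pose del (E' : seq tree) (e : tree) := filter (predC1 e) E'.
apply: (pt_foldl (ed := id) (ec := enc_list id)
  (b := fun a E' e => if dist_table (del E' e) (X a) (k a) == dist_table E' (X a) (k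
      a) then del E' e else E')
  (q := fun _ _ => 0)) => //.
- have Hd : pt (bnd id (bnd (enc_list id) vs)) (fun p => enc_list id (del p.1.2 p.2)).
    apply: (pt_filter (p := fun p e => e != p.2)); first exact: (pt_nth _ 1).
    by apply/pt_neg/pt_eq; [exact: (pt_nth _ 0) | exact: (pt_nth _ 1)].
  have HX2 := @pt_weak2 _ _ _ id (enc_list id) _ _ HX.
  have Hk2 := @pt_weak2 _ _ _ id (enc_list id) _ _ Hk.
  have Ha : pt (bnd id (bnd (enc_list id) vs)) (fun p => enc_list id p.1.2).
    exact: (pt_nth _ 1).
  apply: (pt_ext (f := fun p => if dist_table (del p.1.2 p.2) (X p.1.1) (k p.1.1)
      == dist_table p.1.2 (X p.1.1) (k p.1.1) then enc_list id (del p.1.2 p.2) else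
          enc_list id p.1.2)).
    by move=> p; case: ifP.
  apply: pt_if => //.
  by apply: pt_eq; apply: pt_dist_table.
- exact: bd_const.
by move=> a E' e; rewrite addn0; case: ifP => // _;
    apply/tree_size_sub_map/filter_subseq.
Qed.

Lemma pt_enc_rel A (vs : seq (A -> tree)) (V E : A -> seq tree) :
  pt vs (fun a => enc_list id (V a)) -> pt vs (fun a => enc_list id (E a)) ->
  pt vs (fun a => enc_rel (V a) (E a)).
Proof.
move=> HV HE; apply: (pt_map (ed := id) (f := fun a e =>
  Node (enc_nat (index (thd e) (V a))) (enc_nat (index (ttl e) (V a))))) => //.
have HV1 := @pt_weak _ _ id _ _ HV.
by apply: pt_cons; apply: pt_index => //; [apply: pt_hd | apply: pt_tl]; exact:
    (pt_nth _ 0).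
Qed.

Lemma pt_kernel c : pt [:: enc_input] (kernel c).
Proof.
have f0 : pt [:: enc_input] enc_input by exact: (pt_nth _ 0).
have f1 : pt [:: enc_input] (fun x => enc_list id (in_es x)).
  by apply/pt_list; apply: (pt_ext _ (pt_hd (pt_tl f0))).
have f2 : pt [:: enc_input] (fun x => enc_list enc_pair (in_fs x)).
  by apply: (pt_ext _ (pt_hd (pt_tl (pt_tl f0)))).
have f3 : pt [:: enc_input] in_s.
  by apply: (pt_ext _ (pt_hd (pt_tl (pt_tl (pt_tl f0))))).
have f4 : pt [:: enc_input] in_t.
  by apply: (pt_ext _ (pt_hd (pt_tl (pt_tl (pt_tl (pt_tl f0)))))).
have f5 : pt [:: enc_input] (fun x => enc_nat (in_k x)).
  by apply: (pt_ext _ (pt_hd (pt_tl (pt_tl (pt_tl (pt_tl (pt_tl f0))))))).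
have ff : pt [:: enc_input] (fun x => enc_list id (in_forcing x)).
  apply/pt_list; apply: (pt_map (ed := enc_pair) (f := fun x f =>
    Node (nth Leaf (in_es x) f.1) (nth Leaf (in_es x) f.2))) => //.
  have f1' := @pt_weak _ _ enc_pair _ _ f1.
  have fp : pt (bnd enc_pair [:: enc_input]) (fun p => enc_pair p.2) by exact:
      (pt_nth _ 0).
  apply: pt_cons; apply: pt_nth_seq => //.
    exact: (pt_ext _ (pt_hd fp)).
  exact: (pt_ext _ (pt_tl fp)).
have fsp := pt_undup (pt_ends ff).
have fE : pt [:: enc_input] (fun x => enc_list id
    (kernel_edges (in_es x) (in_forcing x) (in_s x) (in_t x) (in_k x))).
  apply: pt_cat => //; apply: pt_prune => //.
    apply: (pt_filter (p := fun x e => e \notin undup (ends (in_forcing x)))) => //.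
    apply/pt_neg/pt_mem; first exact: (pt_nth _ 0).
    exact: (@pt_weak _ _ id _ _ fsp).
  by do 2!apply: pt_cons => //; apply: pt_ends.
pose kE x := kernel_edges (in_es x) (in_forcing x) (in_s x) (in_t x) (in_k x).
rewrite -/kE in fE.
have fV : pt [:: enc_input] (fun x => enc_list id (kernel_vertices (kE x) (in_s x)
    (in_t x))).
  by apply: pt_undup; do 2!apply: pt_cons => //; apply: pt_ends.
apply: pt_if.
- by apply: pt_ltn; [apply: pt_muln => //; apply: pt_const | exact: pt_size fsp].
- exact: pt_const.
apply: pt_cons; first exact: pt_size fV.
apply: pt_cons; first exact: pt_enc_rel.
apply: pt_cons; first exact: pt_enc_rel.
apply: pt_cons; first exact: pt_index.
apply: pt_cons; first exact: pt_index.
by apply: pt_cons => //; apply: pt_nil.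
Qed.

(** * Correctness and size of the kernel *)

Definition tadj (E : seq tree) : rel tree :=
  fun u v => (Node u v \in E) || (Node v u \in E).

Definition tconn (E : seq tree) (u v : tree) : Prop :=
  exists p, path (tadj E) u p /\ last u p = v.

Definition all_nodes (E : seq tree) : Prop :=
  {in E, forall e, e = Node (thd e) (ttl e)}.

Definition tyes (es fs : seq tree) (s t : tree) (k : nat) : Prop :=
  exists S : seq tree,
    [/\ uniq S, {subset S <= es}, size S <= k, tconn S s t
      & {in fs, forall f, (thd f \in S) || (ttl f \in S)}].

Lemma tadj_sym E : symmetric (tadj E).
Proof. by move=> u v; rewrite /tadj orbC. Qed.

Lemma tadj_sub E E' : {subset E <= E'} -> subrel (tadj E) (tadj E').
Proof. by move=> H u v /orP[] /H; rewrite /tadj => ->; rewrite ?orbT. Qed.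

Lemma tconn_sub E E' u v : {subset E <= E'} -> tconn E u v -> tconn E' u v.
Proof. by move=> H [p [Hp Hl]]; exists p; split=> //; apply: sub_path (tadj_sub H) _
    _ Hp. Qed.

Lemma tconn_trans E u v w : tconn E u v -> tconn E v w -> tconn E u w.
Proof.
move=> [p [Hp <-]] [q [Hq <-]]; exists (p ++ q).
by rewrite cat_path last_cat Hp.
Qed.

Lemma tconn1 E u v : tadj E u v -> tconn E u v.
Proof. by move=> H; exists [:: v]; rewrite /= H. Qed.

Lemma tyes_sub es es' fs s t k :
  {subset es <= es'} -> tyes es fs s t k -> tyes es' fs s t k.
Proof. by move=> H [S [? HS ? ? ?]]; exists S; split=> // e /HS/H. Qed.

(** * Bounded reachability and the walks behind it *)

Lemma stepP E R w :
  reflect (w \in R \/ exists2 e, e \in E &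
             (thd e \in R /\ w = ttl e) \/ (ttl e \in R /\ w = thd e))
          (w \in step E R).
Proof.
rewrite !mem_cat; apply: (iffP or3P) => [[/mapP[e]|/mapP[e]|->]|]; try by left.
- by rewrite mem_filter => /andP[? ?] ->; right; exists e => //; left.
- by rewrite mem_filter => /andP[? ?] ->; right; exists e => //; right.
case=> [|[e eE [[eR ->]|[eR ->]]]]; first by constructor 3.
  by constructor 1; apply: map_f; rewrite mem_filter eR.
by constructor 2; apply: map_f; rewrite mem_filter eR.
Qed.

Lemma reachS E x j : reach E x j.+1 = step E (reach E x j).
Proof. by []. Qed.

Lemma reach_sub E E' x j :
  {subset E <= E'} -> {subset reach E x j <= reach E' x j}.
Proof.
move=> H; elim: j => // j IH y; rewrite !reachS => /stepP Hy; apply/stepP.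
case: Hy => [/IH|[e eE He]]; [by left | right; exists e; first exact: H].
by case: He => -[/IH ? ->]; [left | right].
Qed.

Lemma reach_leq E x i j : i <= j -> {subset reach E x i <= reach E x j}.
Proof.
move=> /subnKC <-; elim: (j - i) => [|m IH] y; first by rewrite addn0.
by rewrite addnS reachS => /IH Hy; apply/stepP; left.
Qed.

Lemma reach_adj E x j y z :
  y \in reach E x j -> tadj E y z -> z \in reach E x j.+1.
Proof.
move=> Hy /orP[] Hz; apply/stepP; right.
  by exists (Node y z) => //; left.
by exists (Node z y) => //; right.
Qed.

(** One edge is collected per step. The length bound thereby becomes a bound on a number of edges,
    which is what the budget counts. *)
Lemma reach_walk E x j y : y \in reach E x j ->
  exists W, [/\ {subset W <= E}, size W <= j & y \in reach W x j].
Proof.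
elim: j y => [|j IH] y; first by exists [::].
rewrite reachS => /stepP[/IH|[e eE He]].
  move=> [W [HW sW Wy]]; exists W; split=> //; first exact: leqW.
  exact: reach_leq (leqnSn j) _ Wy.
have [z Hz zy]: exists2 z, z \in reach E x j &
    (thd e = z /\ y = ttl e) \/ (ttl e = z /\ y = thd e).
  by case: He => -[? ?]; [exists (thd e) | exists (ttl e)]; auto.
have [W [HW sW Wz]] := IH z Hz; exists (e :: W); split=> //.
  by move=> f; rewrite inE => /predU1P[->|/HW].
have Wz' : z \in reach (e :: W) x j.
  by apply: reach_sub Wz => f; rewrite inE orbC => ->.
apply/stepP; right; exists e; first exact: mem_head.
by case: zy Wz' => -[<- ->]; [left | right].
Qed.

Lemma reach_tconn E x j y : all_nodes E -> y \in reach E x j -> tconn E x y.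
Proof.
move=> HE; elim: j y => [|j IH] y; first by rewrite inE => /eqP ->; exists [::].
rewrite reachS => /stepP[/IH //|[e eE [[/IH H ->]|[/IH H ->]]]].
  by apply: tconn_trans H _; apply: tconn1; rewrite /tadj -HE // eE.
by apply: tconn_trans H _; apply: tconn1; rewrite /tadj -HE // eE orbT.
Qed.

Definition same_dist (E E' X : seq tree) (k : nat) : Prop :=
  forall x y j, x \in X -> y \in X -> j <= k ->
    (y \in reach E x j) = (y \in reach E' x j).

Lemma dist_tableP E E' X k :
  reflect (same_dist E E' X k) (dist_table E X k == dist_table E' X k).
Proof.
apply: (iffP eqP) => [/enc_seq_inj/eq_in_map H x y j xX yX jk|H].
  have /enc_seq_inj/eq_in_map/(_ j) := H x xX.
  rewrite mem_rev mem_iota add0n ltnS jk => /(_ isT)/enc_seq_inj/eq_in_map/(_ y yX).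
  exact: enc_bool_inj.
congr enc_seq; apply/eq_in_map => x xX; congr enc_seq; apply/eq_in_map => j.
rewrite mem_rev mem_iota add0n ltnS /= => jk; congr enc_seq.
by apply/eq_in_map => y yX; rewrite (H x y j).
Qed.

(** The reference [E0] stays the original edge set while [E] shrinks; this makes the notion stable
    under later deletions. *)
Definition essential (E0 X : seq tree) (k : nat) (E : seq tree) (e : tree) :=
  exists x y j, [/\ x \in X, y \in X, j <= k, y \in reach E0 x j
                  & y \notin reach (filter (predC1 e) E) x j].

Lemma essential_sub E0 X k E E' e :
  {subset E' <= E} -> essential E0 X k E e -> essential E0 X k E' e.
Proof.
move=> HE [x [y [j [xX yX jk H0 HN]]]]; exists x, y, j; split=> //.
apply: contra HN; apply: reach_sub => f; rewrite !mem_filter => /andP[-> /HE].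
by [].
Qed.

(** Invariant over the processed prefix [l1]: distances are those of [E], and each surviving edge of
    [l1] is essential. The latter persists by [essential_sub]. *)
Lemma pruneP X k E : uniq E ->
  [/\ {subset prune X k E <= E}, uniq (prune X k E),
      same_dist (prune X k E) E X k
    & {in prune X k E, forall e, essential E X k (prune X k E) e}].
Proof.
move=> uE; rewrite /prune; set b := fun E' e => if _ then _ else _.
suff /(_ E [::]): forall l1 l2, E = l1 ++ l2 ->
    [/\ {subset foldl b E l1 <= E}, uniq (foldl b E l1),
      same_dist (foldl b E l1) E X k
    & {in foldl b E l1, forall e, e \in l1 -> essential E X k (foldl b E l1) e}].
  by rewrite cats0 => /(_ erefl)[Hs Hu Hd He]; split=> // e eE; apply/He/Hs.
elim/last_ind=> [|l1 e IH] l2 El; first by split.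
have [|Hs Hu Hd He] := IH (e :: l2); first by rewrite -cat_rcons.
rewrite foldl_rcons; move: (foldl b E l1) Hs Hu Hd He => S Hs Hu Hd He.
rewrite /b; case: (dist_tableP (filter (predC1 e) S) S X k) => HT.
  split.
  - by move=> f; rewrite mem_filter => /andP[_ /Hs].
  - exact: filter_uniq.
  - by move=> x y j xX yX jk; rewrite HT ?Hd.
  - move=> f; rewrite mem_filter mem_rcons inE /= => /andP[fe fS].
    rewrite (negPf fe) /= => /(He f fS); apply: essential_sub => g.
    by rewrite mem_filter => /andP[].
split=> // f fS; rewrite mem_rcons inE => /predU1P[->|]; last exact: He.
(* A failed table comparison must yield a concrete witness; this comes from a boolean search over
   finitely many pairs and lengths. *)
have [J memJ]: exists J : seq nat, forall j, (j \in J) = (j <= k).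
  by exists (iota 0 k.+1) => j; rewrite mem_iota.
have [/hasP[[x y] xyX]|/hasPn Hb] := boolP (has (fun xy => has (fun j =>
   (xy.2 \in reach S xy.1 j) && (xy.2 \notin reach (filter (predC1 e) S) xy.1 j))
   J) [seq (x, y) | x <- X, y <- X]).
  move/allpairsP: xyX => [[x' y'] [/= xX yX [-> ->]]] /hasP[j].
  rewrite memJ => jk /andP[H1 H2].
  by exists x', y', j; split=> //; rewrite -Hd.
case: HT => x y j xX yX jk.
have /hasPn/(_ j) := Hb (x, y) (allpairs_f pair xX yX).
rewrite memJ /= negb_and negbK => /(_ jk) Hj.
apply/idP/idP => [|H1]; first by apply: reach_sub => g; rewrite mem_filter => /andP[].
by move: Hj; rewrite H1.
Qed.

(** For each pair one walk of minimal length [m <= k] is fixed; it serves every [j >= m], so [k]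
    edges per pair suffice for all lengths at once. *)
Lemma short_walks k E (P : seq (tree * tree)) :
  exists L, size L <= size P * k /\ forall x y j, (x, y) \in P -> j <= k ->
    y \in reach E x j -> exists W, [/\ {subset W <= L}, {subset W <= E}
                                    & y \in reach W x j].
Proof.
elim: P => [|[x y] P [L [sL HL]]]; first by exists [::].
have [/hasP[j0 jk Hj]|/hasPn H] :=
  boolP (has (fun j => y \in reach E x j) (iota 0 k.+1)); last first.
  exists L; split=> [|u v j]; first by apply: leq_trans sL _; rewrite /= mulSn leq_addl.
  rewrite inE => /predU1P[[-> ->] jk Hr|]; last exact: HL.
  by have := H j; rewrite mem_iota add0n ltnS jk Hr => /(_ isT).
have Hex : exists j, (y \in reach E x j) by exists j0.
case: (ex_minnP Hex) => m Hm minm.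
have mk : m <= k by move: jk; rewrite mem_iota => /andP[_ ?]; have := minm _ Hj; lia.
have [W [WE sW Wy]] := reach_walk Hm.
exists (W ++ L); split=> [|u v j]; first by rewrite size_cat /= mulSn leq_add //
    (leq_trans sW).
rewrite inE => /predU1P[[-> ->] _ Hr|Hin jk' /(HL _ _ _ Hin jk')].
  exists W; split=> // [e We|]; first by rewrite mem_cat We.
  exact: reach_leq (minm _ Hr) _ Wy.
by move=> [W' [HL' ? ?]]; exists W'; split=> // e /HL'; rewrite mem_cat orbC => ->.
Qed.

(** An edge outside the list [L] of fixed walks is avoided by all of them, so its deletion would
    change no distance, contrary to its being essential. *)
Lemma size_prune X k E : uniq E -> size (prune X k E) <= size X ^ 2 * k.
Proof.
move=> /(pruneP X k); move: (prune X k E) => E' [_ uE' Hd He].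
have [L [sL HL]] := short_walks k E' [seq (x, y) | x <- X, y <- X].
rewrite size_allpairs in sL; rewrite expnS expn1; apply: leq_trans sL.
apply: uniq_leq_size => // e eE'; have [x [y [j [xX yX jk H0 HN]]]] := He e eE'.
have [|W [WL WE Wy]] := HL x y j (allpairs_f pair xX yX) jk; first by rewrite Hd.
apply: WL; apply: contraR HN => eW; apply: reach_sub Wy => f fW.
by rewrite mem_filter /= WE // andbT; apply: contraNneq eW => <-.
Qed.

Lemma mem_ends e E : e \in E -> (thd e \in ends E) /\ (ttl e \in ends E).
Proof. by move=> H; rewrite !mem_cat !map_f ?orbT. Qed.

(** A simple path that has left [z] never returns, so the edge [e] at [z] just traversed can be
    removed from [B] for the rest. This is why no free edge is charged twice. *)
Lemma path_rem A B z e p : e \in [:: Node z (head z p); Node (head z p) z] ->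
  z \notin behead p -> head z p != z ->
  path (tadj (A ++ B)) (head z p) (behead p) ->
  path (tadj (A ++ rem e B)) (head z p) (behead p).
Proof.
move=> He; move: (head z p) (behead p) He => w q He zq zw.
apply: sub_in_path (_ : all (predC1 z) (w :: q)) => [u v /= uz vz|]; last first.
  by rewrite /= zw /=; apply/allP => u uq; apply: contraNneq zq => <-.
have keep f : f \in B -> f != e -> f \in rem e B.
  move=> fB fe; move: fB; elim: B => //= g B IH; rewrite !inE.
  case: (eqVneq g e) => [->|ge]; first by rewrite (negPf fe).
  by rewrite inE; case/predU1P => [->|/IH ->]; rewrite ?eqxx ?orbT.
have ne f : f \in [:: Node u v; Node v u] -> f != e.
  move=> Hf; apply: contraTneq He => <-; move: Hf; rewrite !inE.
  by case/orP => /eqP ->; apply/norP; split; apply/eqP => -[]; move/eqP: uz;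
      move/eqP: vz.
rewrite /tadj !mem_cat => /orP[/orP[->|H]|/orP[->|H]]; rewrite ?orbT //.
  by rewrite (keep _ H) ?orbT // ne // inE eqxx.
by rewrite (keep _ H) ?orbT // ne // !inE eqxx orbT.
Qed.

(* A segment of the solution path through edges of [B] only is replaced by a
   walk in [E'] of the same length: [z] is reached by [j] such edges from the
   last vertex [x] of [X] that was met. *)
Lemma reroute (A F E' X : seq tree) (k : nat) (t : tree) :
  all_nodes E' -> same_dist E' F X k -> t \in X -> {subset ends A <= X} ->
  forall p z x j B, x \in X -> z \in reach F x j -> {subset B <= F} ->
    j + size B <= k -> uniq (z :: p) -> path (tadj (A ++ B)) z p ->
    last z p = t ->
  exists B', [/\ {subset B' <= E'}, size B' <= j + size B & tconn (A ++ B') x t].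
Proof.
move=> HE' Hd tX HA; elim=> [|w p IH] z x j B xX Hz HB jk uz.
  move=> _ zt; rewrite /= in zt; subst z; have jk' : j <= k by lia.
  have [W [WE sW Wt]]: exists W, [/\ {subset W <= E'}, size W <= j & t \in reach W x j].
    by apply: reach_walk; rewrite Hd.
  exists W; split=> //; first by lia.
  apply: (tconn_sub (E := W)) => [e We|]; first by rewrite mem_cat We orbT.
  by apply: reach_tconn Wt => e /WE /HE'.
move=> /= /andP[zw Hp] Hl; have /= /andP[znp uwp] := uz.
have [|zwA] := boolP (tadj A z w).
  move=> zwA; have [zX wX]: z \in X /\ w \in X.
    by case/orP: zwA => /mem_ends[/= ? ?]; split; apply: HA.
  have jk' : j <= k by lia.
  have [W [WE sW Wz]]: exists W, [/\ {subset W <= E'}, size W <= j & z \in reach W x j].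
    by apply: reach_walk; rewrite Hd.
  (* A forced edge closes the open segment at [z], a vertex of [X]; a new segment of length 0 starts
     at [w], also in [X]. *)
  have [|||||||B' [HB' sB' cB']] := IH w w 0 B => //; first by rewrite inE.
    by lia.
  exists (W ++ B'); split.
  - by move=> e; rewrite mem_cat => /orP[/WE|/HB'].
  - by rewrite size_cat; apply: leq_add.
  apply: tconn_trans (_ : tconn _ x z) _.
    apply: (tconn_sub (E := W)) => [e We|]; first by rewrite !mem_cat We orbT.
    by apply: reach_tconn Wz => e /WE /HE'.
  apply: tconn_trans (_ : tconn _ z w) _.
    apply: tconn1; apply: tadj_sub zwA => e; rewrite mem_cat => ->; exact: isT.
  by apply: tconn_sub cB' => e; rewrite !mem_cat => /orP[->|->]; rewrite ?orbT.
have [e eB He]: exists2 e, e \in B & e \in [:: Node z w; Node w z].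
  move: zwA zw; rewrite /tadj !mem_cat negb_or => /andP[/negPf -> /negPf ->] /=.
  by case/orP=> H; [exists (Node z w) | exists (Node w z)]; rewrite ?inE ?eqxx ?orbT.
have szr : size (rem e B) = (size B).-1 by rewrite size_rem.
have B0 : 0 < size B by case: (B) eB.
(* The free edge moves from [B] into the open segment, so [j + size B], the budget for free edges,
   is unchanged. *)
have [|||||||B' [HB' sB' cB']] := IH w x j.+1 (rem e B) => //.
- apply: reach_adj Hz _; rewrite /tadj; move: He; rewrite !inE.
  by case/orP=> /eqP <-; rewrite (HB _ eB) ?orbT.
- by move=> f /mem_rem /HB.
- by lia.
- apply: (@path_rem A B z e (w :: p)) => //=; move: znp; rewrite inE negb_or =>
    /andP[] //.
  by rewrite eq_sym.
by exists B'; split=> //; rewrite addSnnS szr prednK in sB'.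
Qed.

Section Kernel.
Variables (es fs : seq tree) (s t : tree) (k : nat).
Hypotheses (nes : all_nodes es) (ues : uniq es).
Hypothesis (fes : {subset ends fs <= es}).

Let sp := undup (ends fs).
Let X := [:: s, t & ends sp].
Let free := [seq e <- es | e \notin sp].
Let E' := prune X k free.

Lemma kernel_edges_sub : {subset kernel_edges es fs s t k <= es}.
Proof.
move=> e; rewrite mem_cat mem_undup => /orP[/fes //|].
have [|Hs _ _ _] := pruneP X k (E := free); first exact: filter_uniq.
by move/Hs; rewrite mem_filter => /andP[].
Qed.

Lemma kernel_edges_uniq : uniq (kernel_edges es fs s t k).
Proof.
have [|Hs Hu _ _] := pruneP X k (E := free); first exact: filter_uniq.
rewrite cat_uniq undup_uniq Hu andbT /=.
by apply/hasPn => e /Hs; rewrite mem_filter => /andP[].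
Qed.

Lemma kernel_edges_forcing : {subset ends fs <= kernel_edges es fs s t k}.
Proof. by move=> e He; rewrite mem_cat mem_undup He. Qed.

(** The forced part [A] of the solution is kept, the free part [B] is replaced by [B'] with at most
    as many edges. Covering is untouched, as only forced edges occur in [fs]. *)
Lemma kernel_edges_tyes :
  tyes es fs s t k -> tyes (kernel_edges es fs s t k) fs s t k.
Proof.
move=> [S [uS Ses Sk [p [Hp pt] ] Hc]].
have [|Hs Hu Hd _] := pruneP X k (E := free); first exact: filter_uniq.
rewrite -/E' in Hs Hu Hd.
have tX : t \in X by rewrite !inE eqxx orbT.
have sX : s \in X by rewrite !inE eqxx.
pose A := [seq e <- S | e \in sp]; pose B := [seq e <- S | e \notin sp].
have AX : {subset ends A <= X}.
  move=> u; rewrite !inE mem_cat => /orP[] /mapP[e]; rewrite mem_filter => /andP[esp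
      _] ->.
    by rewrite (mem_ends esp).1 !orbT.
  by rewrite (mem_ends esp).2 !orbT.
have sAB : size A + size B = size S by rewrite !size_filter count_predC.
have HBF : {subset B <= free}.
  by move=> e; rewrite !mem_filter => /andP[-> /Ses].
have nE' : all_nodes E'.
  by move=> e /Hs; rewrite mem_filter => /andP[_ /nes].
case/shortenP: Hp pt => q Hq uq _ qt.
have [|||B' [HB' sB' cB']] := reroute nE' Hd tX AX sX (j := 0) (z := s) _ HBF _ uq _ qt.
- by rewrite inE.
- by lia.
- apply: sub_path Hq; apply: tadj_sub => e eS.
  by rewrite mem_cat !mem_filter eS !andbT orbN.
exists (undup (A ++ B')); split.
- exact: undup_uniq.
- move=> e; rewrite mem_undup !mem_cat mem_filter => /orP[/andP[-> //]|/HB' ->].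
  by rewrite orbT.
- by apply: leq_trans (size_undup _) _; rewrite size_cat; lia.
- by apply: tconn_sub cB' => e; rewrite mem_undup.
move=> f ff; rewrite !mem_undup !mem_cat !mem_filter !mem_undup.
rewrite (mem_ends ff).1 (mem_ends ff).2 /=.
by have /orP[->|->] := Hc f ff; rewrite ?orbT.
Qed.

(** The summand [c] counts forced edges. As [k] is positive, [X] has length at most
    [2 + 2ck <= (2 + 2c)k], and its square times [k] bounds the free edges. *)
Lemma size_kernel_edges c : 0 < k -> size sp <= c * k ->
  size (kernel_edges es fs s t k) <= (c + (2 + 2 * c) ^ 2) * k ^ 3.
Proof.
move=> k0 ck; rewrite size_cat -/sp -/X -/free.
have : size (prune X k free) <= size X ^ 2 * k by apply/size_prune/filter_uniq.
have : size X <= (2 + 2 * c) * k.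
  rewrite /X /= size_cat !size_map mulnDl -mulnA; move: (size sp) ck => m ck; lia.
move: (size X) (size (prune X k free)) => x y Hx Hy.
rewrite mulnDl; apply: leq_add.
  apply: leq_trans ck _; rewrite leq_mul2l; apply/orP; right.
  by rewrite -{1}(expn1 k) leq_pexp2l.
apply: leq_trans Hy _; rewrite -[3]/(2 + 1) expnD expn1 mulnA leq_mul2r -expnMn.
by rewrite leq_exp2r // Hx orbT.
Qed.

End Kernel.

Lemma size_kernel_vertices E s t :
  size (kernel_vertices E s t) <= 2 + 2 * size E.
Proof.
by apply: leq_trans (size_undup _) _; rewrite /= size_cat !size_map; lia.
Qed.

(* Outside a cover [S], every element of [ends fs] has a neighbor in [S]. *)
Lemma forced_bound h (es fs : seq tree) s t k :
  (forall S : seq tree, {in fs, forall f, (thd f \in S) || (ttl f \in S)} ->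
     forall b, size [seq a <- undup (ends fs) | (a \notin S) && tadj fs b a] <= h) ->
  all_nodes fs -> tyes es fs s t k -> size (undup (ends fs)) <= (1 + h) * k.
Proof.
move=> Hh nfs [S [uS _ Sk _ Hc]].
(* [L] contains every forced edge: chosen ones, and for each chosen [b] its at most [h] neighbors
   not chosen. *)
pose L := S ++ flatten [seq [seq a <- undup (ends fs) | (a \notin S) && tadj fs b a]
    | b <- S].
apply: leq_trans (_ : size L <= _).
  apply: uniq_leq_size (undup_uniq _) _ => a asp; rewrite mem_cat.
  have [//|aS] := boolP (a \in S).
  have [b bS ba]: exists2 b, b \in S & tadj fs b a.
    move: (asp); rewrite mem_undup mem_cat => /orP[] /mapP[f ff Ea].
      have := Hc f ff; rewrite -Ea (negPf aS) /= => bS; exists (ttl f) => //.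
      by rewrite /tadj Ea -nfs // ff orbT.
    have := Hc f ff; rewrite -Ea (negPf aS) orbF => bS; exists (thd f) => //.
    by rewrite /tadj Ea -nfs // ff.
  by apply/flatten_mapP; exists b => //; rewrite mem_filter aS ba.
rewrite size_cat mulnDl mul1n leq_add // size_flatten /shape -map_comp.
apply: leq_trans (_ : h * size S <= _); last by rewrite leq_mul2l Sk orbT.
elim: {2 3}S => //= b u IH; rewrite mulnS leq_add //.
exact: Hh.
Qed.

(** * Instances as trees *)

(** The edge list of a simple graph in tree form, each edge in exactly one orientation. It serves
    both for G over its vertices and for [G_f] over the edges of G. *)
Definition listing (vs es : seq tree) : Prop :=
  [/\ uniq es, all_nodes es, {subset ends es <= vs},
      {in es, forall e, thd e != ttl e}
    & {in es, forall e, Node (ttl e) (thd e) \notin es}].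

Definition lab (T : Type) (f : T -> tree) (p : T * T) : tree :=
  Node (f p.1) (f p.2).

Notation sets l := [seq [set p.1; p.2] | p <- l].

Lemma lab_inj T (f : T -> tree) : injective f -> injective (lab f).
Proof. by move=> fI [a b] [c d] [/fI -> /fI ->]. Qed.

Lemma set2_eq (T : finType) (a b c d : T) :
  [set a; b] = [set c; d] -> (a, b) = (c, d) \/ (a, b) = (d, c).
Proof.
move=> /setP H; move: (H a) (H b) (H c) (H d); rewrite !inE !eqxx ?orbT /=.
by do 2!case/esym/orP => /eqP ?; do 2!case/orP => /eqP ?; subst; auto.
Qed.

Lemma edge_setE (T : finType) (G : graph T) x y :
  ([set x; y] \in edge_set G) = G x y.
Proof.
apply/imsetP/idP => [[[u v] /=]|Gxy]; last by exists (x, y); rewrite ?inE.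
by rewrite inE /= => Guv /set2_eq[[-> ->]|[-> ->]] //; rewrite adj_sym.
Qed.

Section Listing.
Variables (T : finType) (G : graph T) (l : seq (T * T)) (f : T -> tree).
Hypotheses (Gl : edge_listing G l) (fI : injective f).
Let es := map (lab f) l.

Lemma uniq_sets : uniq (sets l).
Proof. by rewrite (perm_uniq Gl) enum_uniq. Qed.

Lemma mem_sets x y : ([set x; y] \in sets l) = G x y.
Proof. by rewrite (perm_mem Gl) mem_enum edge_setE. Qed.

Lemma mem_lab p : (lab f p \in es) = (p \in l).
Proof. exact: mem_map (lab_inj fI) _ _. Qed.

Lemma tadj_lab x y : tadj es (f x) (f y) = G x y.
Proof.
rewrite /tadj -/(lab f (x, y)) -/(lab f (y, x)) !mem_lab.
apply/orP/idP => [[/(map_f (fun p => [set p.1; p.2]))|/(map_f (fun p => [set p.1;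
    p.2]))]|].
- by rewrite mem_sets.
- by rewrite mem_sets adj_sym.
by rewrite -mem_sets => /mapP[[u v] uvl /= /set2_eq[] [-> ->]]; auto.
Qed.

Lemma listing_lab vs : (forall x, f x \in vs) -> listing vs es.
Proof.
move=> fvs; have adj_l p : p \in l -> G p.1 p.2.
  by move=> pl; rewrite -mem_sets (map_f (fun p => [set p.1; p.2])).
split.
- by rewrite map_inj_uniq ?(map_uniq uniq_sets) //; apply: lab_inj.
- by move=> _ /mapP[p _ ->].
- by move=> u; rewrite mem_cat => /orP[] /mapP[_ /mapP[p _ ->] ->]; apply: fvs.
- move=> _ /mapP[p /adj_l Gp ->] /=; apply: contraTneq Gp => /fI ->.
  by rewrite adj_irrefl.
move=> _ /mapP[p pl ->]; rewrite -[Node _ _]/(lab f (p.2, p.1)) mem_lab.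
apply/negP => ql.
(* Both orientations give the same set, which is listed once; so [p] would equal its own reversal
   and be a loop. *)
have E : (fun p : T * T => [set p.1; p.2]) p = (fun p => [set p.1; p.2]) (p.2, p.1).
  by rewrite /= setUC.
have inj : {in l &, injective (fun p : T * T => [set p.1; p.2])}.
  have := uniq_sets; elim: (l) => //= q u IH /andP[qu /IH {}IH] a b.
  rewrite !inE => /predU1P[->|au] /predU1P[->|bu] // E'; last exact: IH.
    by move: qu; rewrite E' (map_f (fun p => [set p.1; p.2])).
  by move: qu; rewrite -E' (map_f (fun p => [set p.1; p.2])).
have pq := inj _ _ pl ql E.
by move: (adj_l p pl); rewrite pq /= -{1}[p.1]/((p.2,p.1).2) -pq adj_irrefl.
Qed.

Lemma tadj_mem_ends a b (E : seq tree) : tadj E a b -> (a \in ends E) /\ (b \in ends E).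
Proof. by case/orP => /mem_ends[]. Qed.

Lemma ends_lab a : a \in ends es -> exists x, a = f x.
Proof.
by rewrite mem_cat => /orP[] /mapP[_ /mapP[p _ ->] ->]; [exists p.1 | exists p.2].
Qed.

(** Components are cliques exactly when adjacency is transitive on distinct vertices: a path then
    contracts to a single edge. The right-hand side mentions the edge list only. *)
Lemma cluster_lab : cluster_graph G <->
  (forall a b c, tadj es a b -> tadj es b c -> a != c -> tadj es a c).
Proof.
split=> [HG a b c ab bc|Htr x].
  have [/ends_lab[x Ex] /ends_lab[y Ey]] := tadj_mem_ends ab.
  have [_ /ends_lab[z Ez]] := tadj_mem_ends bc.
  move: ab bc; rewrite {}Ex {}Ey {}Ez !tadj_lab (inj_eq fI) => xy yz.
  apply: HG; rewrite inE ?connect0 //.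
  by apply: connect_trans (connect1 xy) (connect1 yz).
have tr u v w : G u v -> G v w -> u != w -> G u w.
  by rewrite -!tadj_lab -(inj_eq fI); apply: Htr.
have step_path p u v : path G u p -> last u p = v -> u != v -> G u v.
  elim/last_ind: p v => [|p w IH] v /=; first by move=> _ ->; rewrite eqxx.
  rewrite rcons_path last_rcons => /andP[Hp lw] <- uw.
  have [E|ne] := eqVneq u (last u p); first by rewrite {1}E.
  exact: tr (IH _ Hp erefl ne) lw uw.
move=> y z; rewrite !inE => xy xz yz.
have /connectP[p Hp Ep] : connect G y z.
  by apply: connect_trans xz; rewrite (sym_connect_sym (adj_sym G)).
exact: step_path Hp (esym Ep) yz.
Qed.

Lemma max_degree_lab eta : max_degree_le eta G <->
  (forall a, size [seq b <- undup (ends es) | tadj es a b] <= eta).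
Proof.
split=> [HG a|HG x].
  (* The tree [a] need not name a vertex; it does as soon as it has a neighbor, and otherwise the
     count is 0. *)
  have [|N] := boolP (has (tadj es a) (undup (ends es))); last first.
    by rewrite size_filter; move: N; rewrite has_count -leqNgt leqn0 => /eqP ->.
  move=> /hasP[b _ /tadj_mem_ends[/ends_lab[x ->] _]].
  apply: leq_trans (HG x); rewrite cardE -(size_map f).
  apply: uniq_leq_size => [|b']; first by rewrite filter_uniq ?undup_uniq.
  rewrite mem_filter mem_undup => /andP[ab /ends_lab[y Ey]]; move: ab; rewrite {}Ey
      tadj_lab => xy.
  by rewrite map_f // mem_enum inE.
apply: leq_trans (HG (f x)); rewrite cardE -(size_map f).
apply: uniq_leq_size => [|_ /mapP[y + ->]].
  by rewrite map_inj_uniq ?enum_uniq.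
rewrite mem_enum inE mem_filter mem_undup /= tadj_lab => xy; rewrite xy.
by have [_ ->] : (f x \in ends es) /\ (f y \in ends es) by apply: tadj_mem_ends;
    rewrite tadj_lab.
Qed.

End Listing.

(** Converse of [listing_lab], used to realize the output. The exclusion of reversed pairs makes the
    passage from pairs to two-element sets injective on [l]. *)
Lemma graph_of_listing (T : finType) (f : T -> tree) (vs es : seq tree) :
  injective f -> {in vs, forall v, exists x, f x = v} -> listing vs es ->
  exists (G : graph T) (l : seq (T * T)),
    edge_listing G l /\ map (lab f) l = es.
Proof.
move=> fI fvs [ues nes ves les ses].
have irr : irreflexive (fun x y => tadj es (f x) (f y)).
  by move=> x; apply/negbTE/norP; split; apply/negP => /les; rewrite /= eqxx.
pose G := @Graph T (fun x y => tadj es (f x) (f y)) (fun x y => tadj_sym es _ _) irr.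
have [l El]: exists l, map (lab f) l = es.
  have: {subset es <= es} by []. elim: {1 3}es => [|e u IH] Hs; first by exists [::].
  have [|l <-] := IH; first by move=> a au; apply: Hs; rewrite inE au orbT.
  have ee : e \in es by apply: Hs; rewrite mem_head.
  have [[x Ex] [y Ey]]: (exists x, f x = thd e) /\ (exists y, f y = ttl e).
    by split; apply: fvs; apply: ves; rewrite ?(mem_ends ee).1 ?(mem_ends ee).2.
  by exists ((x, y) :: l); rewrite /= {1}/lab /= Ex Ey -nes.
exists G, l; split=> //.
have ul : uniq l by move: ues; rewrite -El => /map_uniq.
have lE p : (p \in l) = (lab f p \in es) by rewrite -El (mem_map (lab_inj fI)).
apply: uniq_perm; last first.
- move=> A; rewrite mem_enum; apply/mapP/imsetP => [[p pl ->]|[[x y]]].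
    by exists p => //; rewrite inE /= /tadj -/(lab f p) -lE pl.
  rewrite inE /= /tadj -/(lab f (x, y)) -/(lab f (y, x)) -!lE => /orP[] H ->.
    by exists (x, y).
  by exists (y, x); rewrite // setUC.
- exact: enum_uniq.
rewrite map_inj_in_uniq // => -[a b] [c d] p1 p2 /set2_eq[//|[Ea Eb]].
by have := ses _ (etrans (esym (lE _)) p1); rewrite Ea Eb -[Node _ _]/(lab f (c, d))
    -lE p2.
Qed.

Section EdgeLabels.
Variables (T : finType) (G : graph T) (l : seq (T * T)) (f : T -> tree).
Hypotheses (Gl : edge_listing G l) (fI : injective f).
Let es := map (lab f) l.

(** The oriented pair standing for [e] in the list; its index in [es] is the number by which
    [encodes] names [e]. *)
Definition edge_label (e : edge G) : tree := nth Leaf es (index (val e) (sets l)).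

Lemma edge_in_sets (e : edge G) : val e \in sets l.
Proof. by rewrite (perm_mem Gl) mem_enum (valP e). Qed.

Lemma edge_index_lt (e : edge G) : index (val e) (sets l) < size es.
Proof. by rewrite size_map -(size_map (fun p => [set p.1; p.2])) index_mem
    edge_in_sets. Qed.

Lemma uniq_es : uniq es.
Proof. by rewrite map_inj_uniq ?(map_uniq (uniq_sets Gl)) //; apply: lab_inj. Qed.

Lemma edge_label_in e : edge_label e \in es.
Proof. exact: mem_nth (edge_index_lt e). Qed.

Lemma index_edge_label e : index (edge_label e) es = index (val e) (sets l).
Proof. exact: index_uniq (edge_index_lt e) uniq_es. Qed.

Lemma edge_label_inj : injective edge_label.
Proof.
move=> e e' /(congr1 (index^~ es)); rewrite !index_edge_label => E.
apply: val_inj; rewrite -(nth_index set0 (edge_in_sets e)) E nth_index //.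
exact: edge_in_sets.
Qed.

Lemma edge_labelP e p : p \in l -> val e = [set p.1; p.2] -> edge_label e = lab f p.
Proof.
move=> pl Ee; rewrite /edge_label Ee.
have Ei : index [set p.1; p.2] (sets l) = index p l.
  have pi : index p l < size (sets l) by rewrite size_map index_mem.
  rewrite -[RHS](index_uniq set0 pi (uniq_sets Gl)).
  by rewrite (nth_map p) ?index_mem // nth_index.
by rewrite Ei (nth_map p) ?index_mem // nth_index.
Qed.

Lemma edge_label_onto a : a \in es -> exists e, edge_label e = a.
Proof.
move=> /mapP[p pl ->]; have pG : [set p.1; p.2] \in edge_set G.
  by rewrite -mem_enum -(perm_mem Gl) (map_f (fun p => [set p.1; p.2])).
by exists (exist (fun A : {set T} => A \in edge_set G) _ pG); apply: edge_labelP.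
Qed.

Lemma edge_label_ends e u v : val e = [set u; v] ->
  (edge_label e == lab f (u, v)) || (edge_label e == lab f (v, u)).
Proof.
move=> Ee; have /mapP[p pl Ep] := edge_in_sets e.
rewrite (edge_labelP pl Ep); move: Ep; rewrite Ee; case: p {pl} => a b /= /set2_eq.
by case=> -[-> ->]; rewrite eqxx ?orbT.
Qed.

Lemma sub_adj_label (Es : {set edge G}) (S : seq tree) :
  {subset S <= es} -> (forall e, (edge_label e \in S) = (e \in Es)) ->
  forall u v, sub_adj Es u v = tadj S (f u) (f v).
Proof.
move=> Ses HS u v; apply/exists_inP/orP => [[e eE /eqP /edge_label_ends]|].
  by case/orP => /eqP E; [left | right]; rewrite -HS E in eE.
rewrite -/(lab f (u, v)) -/(lab f (v, u)).
by case=> H; have /mapP[p pl Ep] := Ses _ H; have [e Ee] := edge_label_onto (Ses _ H);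
  exists e; rewrite -?HS ?Ee //; have /mapP[q ql Eq] := edge_in_sets e;
  rewrite Eq; move: Ee; rewrite (edge_labelP ql Eq) => /(lab_inj fI) -> //=; rewrite
      setUC.
Qed.

End EdgeLabels.

Section Instance.
Variables (I : instance) (vsI : seq (ivertex I)) (esI : seq (ivertex I * ivertex I)).
Variables (fsI : seq (edge (igraph I) * edge (igraph I))) (f : ivertex I -> tree).
Hypotheses (vsP : perm_eq vsI (enum (ivertex I))) (esP : edge_listing (igraph I) esI).
Hypotheses (fsP : edge_listing (iforcing I) fsI) (fI : injective f).
Let vs := map f vsI.
Let es := map (lab f) esI.
Let fs := map (lab (edge_label esI f)) fsI.

Lemma instance_listing : listing vs es /\ listing es fs.
Proof.
split; first by apply: (listing_lab esP fI) => x; rewrite map_f // (perm_mem vsP)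
    mem_enum.
apply: (listing_lab fsP (edge_label_inj esP fI)) => e; exact: edge_label_in.
Qed.

Lemma instance_encodes :
  encodes (enc_inst vs es fs (f (isrc I)) (f (idst I)) (ibudget I)) I.
Proof.
exists vsI, esI, fsI; split=> //.
rewrite /enc_inst size_map !index_map //; congr (enc_seq [:: _; _; _; _; _; _]).
  rewrite /enc_rel /enc_edges -map_comp; congr enc_seq; apply: eq_map => p /=.
  by rewrite !index_map.
rewrite /enc_rel /enc_edges -map_comp; congr enc_seq; apply: eq_map => p /=.
by rewrite !index_edge_label.
Qed.

Lemma instance_tyes :
  yes_instance I <-> tyes es fs (f (isrc I)) (f (idst I)) (ibudget I).
Proof.
have lI : injective (edge_label (G := igraph I) esI f) by exact: (edge_label_inj esP
    fI).
split=> [[Es [sE [p [Hp pt _]] Hc]]|[S [uS Ses sS [p [Hp pt]] Hc]]].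
  pose S := [seq edge_label esI f e | e <- enum Es].
  have Ses : {subset S <= es} by move=> _ /mapP[e _ ->]; apply: edge_label_in.
  have HS e : (edge_label esI f e \in S) = (e \in Es) by rewrite mem_map // mem_enum.
  exists S; split=> //.
  - by rewrite map_inj_uniq ?enum_uniq.
  - by rewrite size_map -cardE.
  - exists (map f p); rewrite last_map pt path_map; split=> //.
    apply: sub_path Hp => u v; rewrite /= (sub_adj_label esP fI Ses HS).
    exact.
  - move=> _ /mapP[[a b] abl ->] /=; rewrite !HS; apply: Hc.
    by rewrite -(mem_sets fsP) (map_f (fun p => [set p.1; p.2]) abl).
pose Es := [set e : edge (igraph I) | edge_label esI f e \in S].
have HS e : (edge_label esI f e \in S) = (e \in Es) by rewrite inE.
have sub := sub_adj_label esP fI Ses HS.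
exists Es; split.
- rewrite cardE -(size_map (edge_label esI f)); apply: leq_trans sS.
  apply: uniq_leq_size => [|_ /mapP[e + ->]]; first by rewrite map_inj_uniq ?enum_uniq.
  by rewrite mem_enum HS.
(* After the start, every vertex of the tree path is an endpoint of an edge in [S], hence a
   label. *)
- have [q Eq]: exists q, p = map f q.
    elim: p (f (isrc I)) Hp {pt} => [|a p IH] x /=; first by exists [::].
    move=> /andP[/(tadj_sub Ses)/tadj_mem_ends[_ /ends_lab[y Ey]] /IH[q ->]].
    by exists (y :: q); rewrite Ey.
  move: Hp pt; rewrite Eq last_map path_map => Hq /fI qt.
  have {}Hq : path (sub_adj Es) (isrc I) q by apply: sub_path Hq => u v /=; rewrite sub.
  by case/shortenP: Hq qt => r Hr ur _ rt; exists r.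
move=> a b ab; rewrite -!HS.
have := Hc; rewrite -(tadj_lab fsP lI) in ab.
case/orP: ab => H /(_ _ H) //=; by rewrite orbC.
Qed.

End Instance.

(** Vertices are the positions in [vs]. The list [fsI] and the labelling [g] are returned so that
    membership in the graph class can be transferred through [fs]. *)
Lemma instance_of_listing (vs es fs : seq tree) (s t : tree) (k : nat) :
  uniq vs -> listing vs es -> listing es fs -> s \in vs -> t \in vs ->
  s != t -> 0 < k ->
  exists (I : instance) (fsI : seq (edge (igraph I) * edge (igraph I)))
         (g : edge (igraph I) -> tree),
    [/\ encodes (enc_inst vs es fs s t k) I,
        yes_instance I <-> tyes es fs s t k, #|ivertex I| = size vs
      & [/\ edge_listing (iforcing I) fsI, injective g & map (lab g) fsI = fs]].
Proof.
move=> uvs ves efs svs tvs st k0.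
pose f (i : 'I_(size vs)) := nth Leaf vs i.
have fI : injective f.
  by move=> i j /eqP; rewrite nth_uniq // => /eqP/ord_inj.
have fvs : {in vs, forall v, exists i, f i = v}.
  by move=> v vvs; have vi := vvs; rewrite -index_mem in vi; exists (Ordinal vi);
      rewrite /f nth_index.
have [G [esI [esP Ees]]] := graph_of_listing fI fvs ves.
have lI : injective (edge_label (G := G) esI f) by exact: (edge_label_inj esP fI).
have [|F [fsI [fsP Efs]]] := graph_of_listing (vs := es) lI _ efs.
  by rewrite -{1}Ees => e /(edge_label_onto esP).
have [[i Ei] [j Ej]] := (fvs s svs, fvs t tvs).
have ij : i != j by apply: contraNneq st => E; rewrite -Ei -Ej E.
pose I := @Instance _ G i j k F ij k0.
have vsP : perm_eq (enum 'I_(size vs)) (enum (ivertex I)) by [].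
have Evs : map f (enum 'I_(size vs)) = vs.
  rewrite /f (map_comp (nth Leaf vs) val) val_enum_ord; exact: mkseq_nth.
exists I, fsI, (edge_label esI f); split=> //.
- by have := instance_encodes (I := I) vsP esP fsP fI; rewrite Evs Ees Efs /= Ei Ej.
- by have := instance_tyes (I := I) esP fsP fI; rewrite Ees Efs /= Ei Ej.
- by rewrite card_ord.
Qed.

(** A vertex is labelled by the numeral that names it in the input, so the trees the algorithm
    manipulates are literally parts of the input. *)
Lemma encodes_input (x : tree) (I : instance) : encodes x I ->
  exists (y : input) (fsI : seq (edge (igraph I) * edge (igraph I)))
         (g : edge (igraph I) -> tree) (vs : seq tree),
    [/\ x = enc_input y, in_k y = ibudget I, in_s y != in_t y
      & [/\ listing vs (in_es y), listing (in_es y) (in_forcing y),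
            yes_instance I <-> tyes (in_es y) (in_forcing y) (in_s y) (in_t y) (in_k y)
          & [/\ edge_listing (iforcing I) fsI, injective g
              & map (lab g) fsI = in_forcing y]]].
Proof.
move=> [vsI [esI [fsI [vsP esP fsP ->]]]].
pose f v := enc_nat (index v vsI).
have fI : injective f.
  move=> u v /enc_nat_inj E; have mem w : w \in vsI by rewrite (perm_mem vsP) mem_enum.
  by rewrite -(nth_index u (mem u)) E nth_index.
pose el (e : edge (igraph I)) := index (val e) (sets esI).
pose y := Input (size vsI) (map (lab f) esI) [seq (el p.1, el p.2) | p <- fsI]
  (f (isrc I)) (f (idst I)) (ibudget I).
have Ef : in_forcing y = map (lab (edge_label esI f)) fsI.
  by rewrite /in_forcing /= -map_comp.
exists y, fsI, (edge_label esI f), (map f vsI); split=> //.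
- by rewrite /enc_input /enc_list -map_comp.
- by rewrite /= (inj_eq fI) isrc_neq_idst.
have [H1 H2] := instance_listing vsP esP fsP fI.
rewrite Ef; split=> //; first exact: instance_tyes.
by split=> //; exact: (edge_label_inj esP fI).
Qed.

(** * Conclusion *)

Lemma pt_computes A (enc f : A -> tree) : pt [:: enc] f ->
  exists c a d, forall x, exists n,
    computes c (enc x) n (f x) /\ n <= a * tree_size (enc x) ^ d.
Proof.
move=> Hf; have Bf := pt_bd Hf; case: Hf => F [d0 Hf].
have [d Hd]: bd [:: enc] (fun x => inp [:: enc] x ^ d0 + tree_size (f x) + 2).
  by do ![exact: bd_const | exact: bd_inp | exact: Bf | apply: bd_exp | apply: bd_add].
(* Here [inp] is the input size plus 2, at most 3 times the input size, whence the factor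
   [3 ^ d]. *)
exists (Seq (F [:: 0] 1) (Assign 0 (Var 1))), (3 ^ d), d => x.
have [//|//|n [s' [Hx H1 _ Hn]]] := Hf x [:: 0] 1 (upd (fun=> Leaf) 0 (enc x)).
exists (n + (tree_size (f x)).+1).+1; split.
  exists (upd s' 0 (s' 1)); split; last by rewrite /upd eqxx.
  by apply: ExecSeq Hx _; rewrite -H1; apply: (ExecAssign s' 0 (Var 1)).
apply: leq_trans (_ : _ <= inp [:: enc] x ^ d) _; first by apply: leq_trans (Hd x); lia.
rewrite -expnMn; case: (d) => // e; rewrite leq_exp2r // /inp big_seq1.
have := tree_size_gt0 (enc x); lia.
Qed.

Lemma pt_computable (g : nat -> nat) :
  pt [:: enc_nat] (fun k => enc_nat (g k)) -> computable g.
Proof.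
move=> /pt_computes[c [a [d H]]]; exists c => k.
by have [n [Hn _]] := H k; exists n.
Qed.

(** * Size of the encoded output, and the two kernels *)

Lemma size_enc_rel M (vs es : seq tree) : size vs <= M ->
  tree_size (enc_rel vs es) <= (size es * (4 * M + 4)).+1.
Proof.
move=> HM; have := @tree_size_le_seq (4 * M + 3)
  [seq Node (enc_nat (index (thd e) vs)) (enc_nat (index (ttl e) vs)) | e <- es].
rewrite size_map -[(4 * M + 3).+1]addnS; apply=> _ /mapP[e _ ->] /=.
rewrite !tree_size_nat; have := index_size (thd e) vs; have := index_size (ttl e) vs.
by move: (index _ _) (index _ _) (size vs) HM => i j n; lia.
Qed.

(** The list of [G_f] dominates: up to [M ^ 2] pairs, each written with two unary numerals of size
    O(M). The factor 40 generously absorbs the lower terms. *)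
Lemma size_enc_inst M (vs es fs : seq tree) s t k : 0 < M ->
  size vs <= M -> size es <= M -> size fs <= M ^ 2 -> k <= M ->
  tree_size (enc_inst vs es fs s t k) <= 40 * M ^ 3.
Proof.
move=> M0 Hvs Hes Hfs Hk; rewrite /enc_inst /= !tree_size_nat.
have := size_enc_rel es Hvs; have := size_enc_rel fs Hes.
have := index_size s vs; have := index_size t vs.
have : size es * (4 * M + 4) <= M * (4 * M + 4) by rewrite leq_mul2r Hes orbT.
have : size fs * (4 * M + 4) <= M ^ 2 * (4 * M + 4) by rewrite leq_mul2r Hfs orbT.
have M1 : M <= M ^ 2 by rewrite -{1}(expn1 M) leq_pexp2l.
have M2 : M ^ 2 <= M ^ 3 by rewrite leq_pexp2l.
have -> : M * (4 * M + 4) = 4 * M ^ 2 + 4 * M by rewrite !expnS expn0; lia.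
have -> : M ^ 2 * (4 * M + 4) = 4 * M ^ 3 + 4 * M ^ 2 by rewrite !expnS expn0; lia.
move: (size vs) Hvs (size fs * _) (size es * _) => n Hn x y.
by move: (index s vs) (index t vs) (M ^ 3) (M ^ 2) M1 M2 => i j m3 m2; lia.
Qed.

Lemma size_listing (vs es : seq tree) : listing vs es -> size es <= size vs ^ 2.
Proof.
move=> [ues nes ves _ _]; rewrite expnS expn1 -(size_allpairs Node).
apply: uniq_leq_size => // e eE; rewrite (nes e eE).
by apply: allpairs_f; apply: ves; rewrite ?(mem_ends eE).1 ?(mem_ends eE).2.
Qed.

Lemma listing_sub (vs vs' es es' : seq tree) :
  uniq es' -> {subset es' <= es} -> {subset ends es' <= vs'} ->
  listing vs es -> listing vs' es'.
Proof.
move=> ues' sub ends' [_ nes _ les ses]; split=> // e /sub He.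
- exact: nes.
- exact: les.
- by apply: contra (ses e He); apply: sub.
Qed.

(** Common part of both classes. [Q] expresses [P] on the edge list of [G_f], which the kernel
    leaves unchanged; [Q [::]] covers the constant no-instance. *)
Lemma kernel_of_forced_bound (P : instance -> Prop) (Q : seq tree -> Prop) (c : nat) :
  (forall I (l : seq (edge (igraph I) * edge (igraph I))) (g : edge (igraph I) -> tree),
     edge_listing (iforcing I) l -> injective g -> P I <-> Q (map (lab g) l)) ->
  Q [::] ->
  (forall es fs s t k, Q fs -> all_nodes fs -> tyes es fs s t k ->
     size (undup (ends fs)) <= c * k) ->
  exists C, admits_kernel P (fun k => C * k ^ 3).
Proof.
(* The kernel vertices are the two terminals and at most two endpoints per kept edge. *)
move=> HPQ Q0 Hc; pose C := 2 + 2 * (c + (2 + 2 * c) ^ 2); exists C.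
have [prog [a [d Hprog]]] := pt_computes (pt_kernel c).
exists prog, a, d, (fun k => 40 * (C * k ^ 3) ^ 3); split.
  apply: pt_computable; apply: pt_muln; first exact: pt_const.
  apply: pt_expn; apply: pt_muln; first exact: pt_const.
  by apply: pt_expn; exact: (pt_nth _ 0).
move=> _ I /encodes_input[x [l [g [vs [-> Ek st [ves efs HI [lP gI El]]]]]]] PI.
have [n [Hn na]] := Hprog x; exists n.
have Qfs : Q (in_forcing x) by rewrite -El -(HPQ I).
have k0 : 0 < in_k x by rewrite Ek ibudget_gt0.
have C0 : 2 <= C by rewrite /C leq_addr.
have M2 : 2 <= C * in_k x ^ 3.
  by apply: leq_trans C0 _; rewrite leq_pmulr // expn_gt0 k0.
have M0 := ltnW M2.
have [ues nes _ _ _] := ves; have [_ nfs fes _ _] := efs; rewrite -Ek.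
rewrite /kernel in Hn; case: ltnP Hn => [Hbig|Hsmall] Hn.
  have [J [lJ [gJ [HJ yJ cJ [lJP gJI El']]]]] :
      exists (J : instance) (fsJ : seq (edge (igraph J) * edge (igraph J)))
         (gJ : edge (igraph J) -> tree),
    [/\ encodes no_inst J,
        yes_instance J <-> tyes [::] [::] Leaf (Node Leaf Leaf) 1, #|ivertex J| = 2
      & [/\ edge_listing (iforcing J) fsJ, injective gJ & map (lab gJ) fsJ = [::]]].
    exact: instance_of_listing.
  exists no_inst, J; split=> //.
  - by split=> //; apply/(HPQ _ _ _ lJP gJI); rewrite El'.
  (* Neither side is a yes-instance: the input has more than [c * k] forced edges, and the constant
     instance has no edge joining its distinct terminals. *)
  - split=> [/HI/(Hc _ _ _ _ _ Qfs nfs)|/yJ[S [_ HS _ [p [Hp pt]] _]]].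
      by rewrite leqNgt Hbig.
    case: p Hp pt => [//|v p] /= /andP[/orP[] /HS //].
  - exact: (@size_enc_inst (C * in_k x ^ 3)).
  - by rewrite cJ.
move: Hn; set E := kernel_edges _ _ _ _ _; set K := kernel_vertices _ _ _ => Hn.
have uE : uniq E by apply: kernel_edges_uniq.
have subE : {subset E <= in_es x} by apply: kernel_edges_sub.
have listKE : listing K E.
  apply: listing_sub ves => // v vE; rewrite mem_undup !inE vE !orbT; exact: isT.
have listEf : listing E (in_forcing x).
  have [ufs _ _ _ _] := efs; apply: listing_sub efs => //.
  exact: kernel_edges_forcing.
have sE := size_kernel_edges (in_s x) (in_t x) ues k0 Hsmall.
have sK : size K <= C * in_k x ^ 3.
  apply: leq_trans (size_kernel_vertices _ _ _) _; rewrite /C mulnDl leq_add //.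
    by rewrite leq_pmulr // expn_gt0 k0.
  by rewrite -mulnA leq_mul2l sE orbT.
have [||J [lJ [gJ [HJ yJ cJ [lJP gJI El']]]]] :=
    instance_of_listing (undup_uniq _) listKE listEf _ _ st k0.
- by rewrite mem_undup !inE eqxx.
- by rewrite mem_undup !inE eqxx orbT.
exists (enc_inst K E (in_forcing x) (in_s x) (in_t x) (in_k x)), J; split=> //.
- by split=> //; apply/(HPQ _ _ _ lJP gJI); rewrite El'.
- rewrite HI yJ; split; last exact: tyes_sub.
  exact: kernel_edges_tyes.
- have sEM : size E <= C * in_k x ^ 3.
    apply: leq_trans sE _; rewrite leq_mul2r; apply/orP; right; rewrite /C; lia.
  apply: size_enc_inst => //.
    by apply: leq_trans (size_listing listEf) _; rewrite leq_exp2r.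
  apply: leq_trans (_ : in_k x ^ 3 <= _); last by rewrite leq_pmull //; lia.
  by rewrite -{1}(expn1 (in_k x)) leq_pexp2l.
by rewrite cJ.
Qed.

(** Two neighbors of [b] outside the cover would be adjacent by transitivity and leave an edge
    uncovered. So [h = 1], which gives [(1 + 1) * k]. *)
Lemma cluster_forced_bound (es fs : seq tree) s t k :
  (forall a b c, tadj fs a b -> tadj fs b c -> a != c -> tadj fs a c) ->
  all_nodes fs -> tyes es fs s t k -> size (undup (ends fs)) <= 2 * k.
Proof.
move=> tr; apply: (@forced_bound 1) => S HS b.
set l := filter _ _; have ul : uniq l by rewrite filter_uniq ?undup_uniq.
have in_l a : a \in l -> a \notin S /\ tadj fs b a.
  by rewrite mem_filter => /andP[/andP[]].
case: l ul in_l => [|a [|a' l]] //= /andP[aa' _] in_l.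
have [aS ba] := in_l a (mem_head _ _).
have [a'S ba'] : a' \notin S /\ tadj fs b a' by apply: in_l; rewrite !inE eqxx orbT.
have : tadj fs a a'.
  apply: tr ba' _; first by rewrite tadj_sym.
  by move: aa'; rewrite inE negb_or => /andP[].
by case/orP => /HS /=; rewrite (negPf aS) (negPf a'S).
Qed.

Theorem theorem4 :
  (exists C : nat,
     admits_kernel (fun I : instance => cluster_graph (iforcing I))
                   (fun k : nat => C * k ^ 3))
  /\
  (forall eta : nat, exists C : nat,
     admits_kernel (fun I : instance => max_degree_le eta (iforcing I))
                   (fun k : nat => C * k ^ 3)).
Proof.
split=> [|eta].
  apply: (kernel_of_forced_bound (Q := fun fs => forall a b c,
    tadj fs a b -> tadj fs b c -> a != c -> tadj fs a c) (c := 2)) => //.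
    by move=> I l g lP gI; apply: cluster_lab.
  by move=> es fs s t k; apply: cluster_forced_bound.
apply: (kernel_of_forced_bound (Q := fun fs => forall a,
  size [seq b <- undup (ends fs) | tadj fs a b] <= eta) (c := 1 + eta)) => //.
  by move=> I l g lP gI; apply: max_degree_lab.
move=> es fs s t k deg; apply: forced_bound => S _ b.
apply: leq_trans (deg b); rewrite !size_filter; apply: sub_count => a /andP[_].
exact.
Qed.
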